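(* Let $\Omega'\subseteq\{0,1,2\}^\infty$ be the set of sequences $\omega=\omega_0\omega_1\ldots$ for which there exists $k\in\mathbb{N}$ such that in every $k$-block $\omega_{k(i-1)}\ldots\omega_{ki-1}$, $i\in\mathbb{N}$ ($i\ge1$), all three letters $0,1,2$ appear. For every $\omega\in\Omega'$, all IRSs of the Grigorchuk group $G_\omega$ are co-sofic.
   Context: An IRS of a countable group $G$ is a Borel probability measure on $\mathrm{Sub}(G)\subset\{0,1\}^G$ (product topology) invariant under conjugation. An IRS is co-sofic if it is a weak-$*$ limit of IRSs supported on finite index subgroups. Automorphisms of the binary rooted tree act on the right; $g=(g_0,g_1)\sigma$ means $(vw)\cdot g=(v\cdot\sigma)(w\cdot g_v)$ for $v\in\{0,1\}$ and words $w$. Let $0,1,2$ denote the three non-trivial homomorphisms from $\mathbb{Z}/2\mathbb{Z}\times\mathbb{Z}/2\mathbb{Z}=\{id,b,c,d\}$ to $\mathbb{Z}/2\mathbb{Z}=\{id,a\}$. For $\omega=\omega_0\omega_1\ldots\in\{0,1,2\}^\infty$, with shift $\mathfrak{s}\omega=\omega_1\omega_2\ldots$, the Grigorchuk group $G_\omega$ is the group of automorphisms of the binary rooted tree generated by $a,b_\omega,c_\omega,d_\omega$, where $a=\varepsilon$ is the root permutation exchanging the two subtrees of the root, and recursively $b_\omega=(\omega_0(b),b_{\mathfrak{s}\omega})$, $c_\omega=(\omega_0(c),c_{\mathfrak{s}\omega})$, $d_\omega=(\omega_0(d),d_{\mathfrak{s}\omega})$. *)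

(* Defs.v *)
From HB Require Import structures.
From mathcomp Require Import all_boot all_order all_algebra.
From mathcomp Require Import all_classical all_reals all_analysis.
Import Order.TTheory GRing.Theory Num.Theory numFieldNormedType.Exports.

Set Implicit Arguments.
Unset Strict Implicit.
Unset Printing Implicit Defensive.

Local Open Scope classical_set_scope.

(* A point of {0,1}^G is a boolean predicate on G. *)
Definition subgroup_set (G : groupType) : set {ptws G -> bool} :=
  [set H | group_closed (H : {pred G})].
Arguments subgroup_set G : clear implicits.

(* [set_type] carries the subspace topology, here that of the product
   topology on {0,1}^G. *)
Definition SubSpace (G : groupType) : Type := set_type (subgroup_set G).

HB.instance Definition _ (G : groupType) :=
  Topological.copy (SubSpace G) (set_type (subgroup_set G)).

Definition pred_of_Sub (G : groupType) (H : SubSpace G) : {pred G} := \val H.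

Lemma pred_of_SubP (G : groupType) (H : SubSpace G) :
  group_closed (pred_of_Sub H).
Proof. exact: (set_mem (valP H)). Qed.

Definition mkSub (G : groupType) (H : {pred G}) (cH : group_closed H) :
    SubSpace G :=
  exist (fun H : {ptws G -> bool} => H \in subgroup_set G) H
    (@mem_set _ (subgroup_set G) H cH).

Lemma group_closedT (G : groupType) : group_closed (predT : {pred G}).
Proof. by []. Qed.

HB.instance Definition _ (G : groupType) :=
  isPointed.Build (SubSpace G) (mkSub (@group_closedT G)).

HB.instance Definition _ (G : groupType) :=
  Measurable.copy (SubSpace G) (g_sigma_algebraType (@open (SubSpace G))).

(* x lies in H^g = g^-1 H g iff g x g^-1 lies in H. *)
Definition conj_pred (G : groupType) (g : G) (H : SubSpace G) : {pred G} :=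
  fun x => (x ^ g^-1)%g \in pred_of_Sub H.

Lemma conj_pred_closed (G : groupType) (g : G) (H : SubSpace G) :
  group_closed (conj_pred g H).
Proof.
have [H1 HB] := pred_of_SubP H; split=> [|x y]; rewrite !unfold_in /=.
  by rewrite conj1g.
by move=> xH yH; rewrite conjMg conjVg; exact: HB.
Qed.

Definition conj_Sub (G : groupType) (g : G) (H : SubSpace G) : SubSpace G :=
  mkSub (conj_pred_closed g H).

Definition is_IRS (R : realType) (G : groupType)
    (mu : probability (SubSpace G) R) : Prop :=
  forall (g : G) (A : set (SubSpace G)), measurable A ->
    mu (conj_Sub g @^-1` A) = mu A.

Definition right_coset (G : groupType) (H : SubSpace G) (x : G) : set G :=
  [set (h * x)%g | h in [set h | h \in pred_of_Sub H]].

Definition finite_index (G : groupType) (H : SubSpace G) : Prop :=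
  finite_set (range (right_coset H)).

Definition weak_star_cvg (R : realType) (G : groupType)
    (nu : nat -> probability (SubSpace G) R)
    (mu : probability (SubSpace G) R) : Prop :=
  forall f : SubSpace G -> R, continuous f ->
    (fun n => \int[nu n]_H f H)%R @ \oo --> (\int[mu]_H f H)%R.

(* Sequential limits are enough: for countable G the space SubSpace G is
   compact and metrizable, hence so is the weak-* topology on its probabilities. *)
Definition co_sofic (R : realType) (G : groupType)
    (mu : probability (SubSpace G) R) : Prop :=
  exists nu : nat -> probability (SubSpace G) R,
    [/\ forall n, is_IRS (nu n),
        forall n, {ae nu n, forall H, finite_index H} &
        weak_star_cvg nu mu].

(* Vertices are the finite binary words, the root being the empty word. *)
Definition adjacent (u v : seq bool) : Prop :=
  (exists x, v = rcons u x) \/ (exists x, u = rcons v x).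

Definition tree_automorphism : set (seq bool -> seq bool) :=
  [set f | [/\ bijective f, f [::] = [::] &
               forall u v, adjacent (f u) (f v) <-> adjacent u v]].

Definition treeAut : Type := set_type tree_automorphism.

HB.instance Definition _ := SubChoice.copy treeAut (set_type tree_automorphism).

(* [act g w] is the image w . g of w under the right action. *)
Definition act (g : treeAut) : seq bool -> seq bool := \val g.

Definition mkAut (f : seq bool -> seq bool) (cf : tree_automorphism f) :
  treeAut := exist (fun f => f \in tree_automorphism) f (mem_set cf).

Lemma act_mkAut f (cf : tree_automorphism f) : act (mkAut cf) = f.
Proof. by []. Qed.

Lemma actP (g : treeAut) : tree_automorphism (act g).
Proof. exact: (set_mem (valP g)). Qed.

Lemma act_inj : injective act.
Proof. exact: val_inj. Qed.

Lemma tree_automorphism1 : tree_automorphism id.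
Proof. by split=> //; exists id. Qed.

Lemma tree_automorphismM f g : tree_automorphism f -> tree_automorphism g ->
  tree_automorphism (g \o f).
Proof.
move=> [bf f0 fa] [bg g0 ga]; split=> [||u v].
- exact: bij_comp.
- by rewrite /= f0 g0.
- by apply: iff_trans (fa u v); exact: ga.
Qed.

Definition inv_fun (f : seq bool -> seq bool) (w : seq bool) : seq bool :=
  xget w [set u | f u = w].

Lemma inv_funK f : bijective f -> cancel f (inv_fun f) /\ cancel (inv_fun f) f.
Proof.
move=> [g fK gK]; have h w : f (inv_fun f w) = w.
  by rewrite /inv_fun; case: xgetP => // /(_ (g w)); rewrite /= gK.
by split=> // w; apply: (can_inj fK).
Qed.

Lemma tree_automorphismV f : tree_automorphism f ->
  tree_automorphism (inv_fun f).
Proof.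
move=> [bf f0 fa]; have [fK Kf] := inv_funK bf; split=> [||u v].
- by exists f.
- by rewrite -[in LHS]f0 fK.
- by have := fa (inv_fun f u) (inv_fun f v); rewrite !Kf => -[? ?].
Qed.

Definition aut_one : treeAut := mkAut tree_automorphism1.

(* Right action: w . (g h) = (w . g) . h. *)
Definition aut_mul (g h : treeAut) : treeAut :=
  mkAut (tree_automorphismM (actP g) (actP h)).

Definition aut_inv (g : treeAut) : treeAut :=
  mkAut (tree_automorphismV (actP g)).

Lemma aut_mulA : associative aut_mul.
Proof. by move=> g h k; exact: act_inj. Qed.

Lemma aut_mul1g : left_id aut_one aut_mul.
Proof. by move=> g; exact: act_inj. Qed.

Lemma aut_mulg1 : right_id aut_one aut_mul.
Proof. by move=> g; exact: act_inj. Qed.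

Lemma aut_mulVg : left_inverse aut_one aut_inv aut_mul.
Proof.
move=> g; apply: act_inj; apply/funext=> w /=.
by have [bg _ _] := actP g; exact: (inv_funK bg).2.
Qed.

Lemma aut_mulgV : right_inverse aut_one aut_inv aut_mul.
Proof.
move=> g; apply: act_inj; apply/funext=> w /=.
by have [bg _ _] := actP g; exact: (inv_funK bg).1.
Qed.

HB.instance Definition _ := isGroup.Build treeAut
  aut_mulA aut_mul1g aut_mulg1 aut_mulVg aut_mulgV.

(* The target {id, a} of the homomorphisms is encoded by bool, with a = true,
   and the Klein four-group by bool * bool with componentwise xor. *)
Definition klein : Type := (bool * bool)%type.
Definition kmul (x y : klein) : klein := (x.1 (+) y.1, x.2 (+) y.2).
Definition kb : klein := (true, false).
Definition kc : klein := (false, true).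
Definition kd : klein := (true, true).

(* The usual labelling: 0, 1, 2 have respective kernels <d>, <c>, <b>. *)
Definition khom (i : 'I_3) (x : klein) : bool :=
  match val i with
  | 0 => x.1 (+) x.2
  | 1 => x.1
  | _ => x.2
  end.

Lemma khom_inj : injective khom.
Proof.
move=> i j /funeqP h; have hb := h kb; have hc := h kc; move: hb hc.
by case: i j {h} => [[|[|[|//]]] ?] [[|[|[|//]]] ?] //= _ _; exact: val_inj.
Qed.

Lemma khomP (phi : klein -> bool) :
  ({morph phi : x y / kmul x y >-> x (+) y} /\ exists x, phi x) <->
  exists i, phi = khom i.
Proof.
split=> [[phiM [x0 phix0]]|[i ->]]; last first.
  split; last by case: i => [[|[|[|//]]] ?]; [exists kb|exists kb|exists kc].
  by case: i => [[|[|[|//]]] ?] [[] []] [[] []].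
have phi0 : phi (false, false) = false.
  by have := phiM kb kb; rewrite addbb.
have phid : phi kd = phi kb (+) phi kc by rewrite -phiM.
case pb: (phi kb); case pc: (phi kc).
- exists ord0; apply/funext=> -[[] []]; rewrite /khom //= ?phi0 //.
  by rewrite -/kd phid pb pc.
- exists (@Ordinal 3 1 isT); apply/funext=> -[[] []]; rewrite /khom //= ?phi0 //.
  by rewrite -/kd phid pb pc.
- exists (@Ordinal 3 2 isT); apply/funext=> -[[] []]; rewrite /khom //= ?phi0 //.
  by rewrite -/kd phid pb pc.
- by case: x0 phix0 => [[] []]; rewrite -?/kb -?/kc -?/kd ?phid ?phi0 ?pb ?pc.
Qed.

Definition shift_seq (omega : nat -> 'I_3) : nat -> 'I_3 := fun n => omega n.+1.

Definition flip (w : seq bool) : seq bool :=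
  if w is v :: w' then ~~ v :: w' else [::].

(* The action of x_omega = (omega_0(x), x_(shift omega)) for x in {b, c, d};
   the first letter false (resp. true) stands for 0 (resp. 1). *)
Fixpoint spinal (x : klein) (omega : nat -> 'I_3) (w : seq bool) : seq bool :=
  match w with
  | [::] => [::]
  | false :: w' => false :: (if khom (omega 0) x then flip w' else w')
  | true :: w' => true :: spinal x (shift_seq omega) w'
  end.

Lemma flipK : involutive flip.
Proof. by case=> //= v w; rewrite negbK. Qed.

Lemma flip_rcons u v : exists v', flip (rcons u v) = rcons (flip u) v'.
Proof. by case: u => [|y u] /=; [exists (~~ v)|exists v]. Qed.

Lemma spinalK x omega : involutive (spinal x omega).
Proof.
move=> w; elim: w omega => [|[] w IH] omega //=; first by rewrite IH.
by case: (khom _ _) => //; rewrite flipK.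
Qed.

Lemma spinal_rcons x omega u v :
  exists v', spinal x omega (rcons u v) = rcons (spinal x omega u) v'.
Proof.
elim: u omega => [|[] u IH] omega /=.
- by exists v; case: v => //; case: (khom _ _).
- by have [v' ->] := IH (shift_seq omega); exists v'.
- case: (khom _ _); last by exists v.
  by have [v' ->] := flip_rcons u v; exists v'.
Qed.

Lemma involution_tree_automorphism f : involutive f -> f [::] = [::] ->
  (forall u v, exists v', f (rcons u v) = rcons (f u) v') ->
  tree_automorphism f.
Proof.
move=> fK f0 fr.
have fa u v : adjacent u v -> adjacent (f u) (f v).
  by case=> -[x ->]; [left|right]; exact: fr.
split=> // [|u v]; first by exists f.
by split=> [/fa|/fa//]; rewrite !fK.
Qed.

Definition gen_a : treeAut :=
  mkAut (involution_tree_automorphism flipK erefl flip_rcons).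

Definition gen_spinal (x : klein) (omega : nat -> 'I_3) : treeAut :=
  mkAut (involution_tree_automorphism (spinalK x omega) erefl
           (spinal_rcons x omega)).

Definition gen_b := gen_spinal kb.
Definition gen_c := gen_spinal kc.
Definition gen_d := gen_spinal kd.

(* [wreath s g g0 g1] says that g = (g0, g1) s. *)
Definition wreath (s : bool -> bool) (g g0 g1 : treeAut) : Prop :=
  forall (v : bool) (w : seq bool),
    act g (v :: w) = s v :: act (if v then g1 else g0) w.

Lemma gen_a_wreath : wreath negb gen_a 1%g 1%g.
Proof. by move=> [] w. Qed.

Lemma gen_spinal_wreath x omega :
  wreath id (gen_spinal x omega)
    (if khom (omega 0) x then gen_a else 1%g) (gen_spinal x (shift_seq omega)).
Proof. by case=> w //; rewrite /act /=; case: (khom _ _). Qed.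

Definition grigorchuk_set (omega : nat -> 'I_3) : set treeAut :=
  smallest [set H : set treeAut | group_closed [pred g | g \in H]]
    [set gen_a; gen_b omega; gen_c omega; gen_d omega].

Definition grigorchuk (omega : nat -> 'I_3) : Type :=
  set_type (grigorchuk_set omega).

HB.instance Definition _ (omega : nat -> 'I_3) :=
  SubChoice.copy (grigorchuk omega) (set_type (grigorchuk_set omega)).

Lemma grigorchuk_closed (omega : nat -> 'I_3) :
  group_closed (fun g => g \in grigorchuk_set omega).
Proof.
split=> [|g h Gg Gh]; apply: (@mem_set _ (grigorchuk_set omega)) => H HP.
  by case: HP => -[H1 _] _; exact: set_mem H1.
have [[_ HB] _] := HP; apply: set_mem; apply: HB; apply: mem_set.
- exact: (set_mem (Gg : g \in grigorchuk_set omega)).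
- exact: (set_mem (Gh : h \in grigorchuk_set omega)).
Qed.

HB.instance Definition _ (omega : nat -> 'I_3) :=
  SubChoice_isSubGroup.Build treeAut _ (grigorchuk omega)
    (grigorchuk_closed omega).

Definition Omega' : set (nat -> 'I_3) :=
  [set omega | exists k : nat, forall i : nat, (1 <= i)%N ->
    forall x : 'I_3, exists j : nat,
      (k * (i - 1) <= j < k * i)%N /\ omega j = x].

(* Main.v *)
(* Let F be the closed set of boundary points of the tree fixed by a random
   subgroup H distributed as the IRS. The approximations of H are the groups
   Phi_n H generated by the elements of H that are trivial below the level n
   vertices meeting F, together with all the elements of G that are supported
   below these vertices and fix them. Since H |-> Phi_n H is equivariant, the
   law of Phi_n H is an IRS.

   - Phi_n H has finite index. The group G branches over subgroups K whose
     derived subgroups contain the copies of K at deeper levels. If h in H moves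
     a vertex v, a recurrence argument shows that, almost surely, for all w far
     enough below v, H contains the derived subgroup of a subgroup of finite
     index of the copy of K below w. Hence H contains all the copies of K far
     below the vertices that do not meet F.

   - Phi_n H -> H almost surely. It suffices that any g in G fixing F pointwise
     be trivial near F. By contraction the only obstruction is a point x = v1^oo
     of F isolated from the vertices v1^k0 for infinitely many k. By level
     transitivity the probability q_n that a vertex of level n meets F depends
     only on n, and such an event has probability at most q_n - q_(n+1) for
     infinitely many n, hence 0. *)

Require Import Defs.
From mathcomp Require Import all_boot all_order all_algebra.
From mathcomp Require Import all_classical all_reals all_analysis.
From mathcomp Require Import measurable_realfun.
Import Order.TTheory GRing.Theory Num.Theory numFieldNormedType.Exports.

Set Implicit Arguments.
Unset Strict Implicit.
Unset Printing Implicit Defensive.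

Local Open Scope classical_set_scope.
Local Open Scope group_scope.

(** * Tree automorphisms and their sections *)

(** The recurrence argument runs twice. For k in H, the q in K_v with k^(q^-1) in H are so frequent
    that any subgroup containing them has finite index in K_v. For k = h moving v, this puts into H
    products x y, with x running over a finite index subgroup of K_v and y living below another
    vertex of the same level. A priori H might contain only such coupled products and meet K_v
    trivially. But y centralizes K_v, so x normalizes the intersection N of H and K_v. A second
    recurrence, for k = x y and q normalizing N, yields commutators [q, x] that do lie in N. If x
    moves a vertex w below v, then s^x commutes with K_w for s in K_w, and [[s, x], t] is a
    conjugate of [s^-1, t]: this eliminates x. Only commutators are reached in this way, whence a
    branching condition on derived subgroups. K is the normal closure of [a, z] for a non-trivial z
    in the Klein group; z has to follow the letters of omega from level to level. The condition on
    omega enters through [recurrent]: each non-trivial element of the Klein group is killed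
    infinitely often, and acts as a infinitely often. *)

Lemma actM g h w : act (g * h) w = act h (act g w).
Proof. by []. Qed.

Lemma act1 w : act 1 w = w.
Proof. by []. Qed.

Lemma actK g : cancel (act g) (act g^-1).
Proof. by move=> w; rewrite -actM mulgV. Qed.

Lemma actVK g : cancel (act g^-1) (act g).
Proof. by move=> w; rewrite -actM mulVg. Qed.

Lemma eq_act g h : (forall w, act g w = act h w) -> g = h.
Proof. by move=> gh; apply: act_inj; apply/funext. Qed.

Lemma act_nil g : act g [::] = [::].
Proof. by have [] := actP g. Qed.

Lemma act_rcons g u x : exists x', act g (rcons u x) = rcons (act g u) x'.
Proof.
have [_ g0 gadj] := actP g; elim/last_ind: u x => [|u y IH] x.
  have /gadj : Defs.adjacent [::] (rcons [::] x) by left; exists x.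
  by rewrite g0 => -[[x' ->]|[x' /(congr1 size)]]; [exists x'|rewrite size_rcons].
have /gadj [[x' ->]|[x' e]] : Defs.adjacent (rcons u y) (rcons (rcons u y) x).
- by left; exists x.
- by exists x'.
have [y' e'] := IH y; move: e; rewrite e' => /rcons_inj [/(can_inj (actK g)) e _].
by move: (congr1 size e); rewrite !size_rcons => /eqP; rewrite ltn_eqF.
Qed.

Lemma size_act g u : size (act g u) = size u.
Proof.
elim/last_ind: u => [|u x IH]; first by rewrite act_nil.
by have [x' ->] := act_rcons g u x; rewrite !size_rcons IH.
Qed.

Lemma act_cat g u w : exists w', act g (u ++ w) = act g u ++ w'.
Proof.
elim/last_ind: w => [|w x [w' IH]]; first by exists [::]; rewrite !cats0.
have [x' e] := act_rcons g (u ++ w) x.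
by exists (rcons w' x'); rewrite -!rcons_cat e IH.
Qed.

Lemma act_take g n w : act g (take n w) = take n (act g w).
Proof.
have [nw|wn] := leqP n (size w); last first.
  by rewrite !take_oversize// ?size_act ltnW.
have [w' e] := act_cat g (take n w) (drop n w).
by rewrite cat_take_drop in e; rewrite e take_size_cat// size_act size_takel.
Qed.

(** A relation rather than a function: sections are never built for arbitrary automorphisms, they
    are exhibited for elements of G from those of the generators. *)
Definition section (g : treeAut) (v v' : seq bool) (s : treeAut) : Prop :=
  forall w, act g (v ++ w) = v' ++ act s w.

Lemma section_act g v v' s : section g v v' s -> act g v = v'.
Proof. by move/(_ [::]); rewrite act_nil !cats0. Qed.

Lemma section1 v : section 1 v v 1.
Proof. by []. Qed.

Lemma sectionM g h v v' v'' s t :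
  section g v v' s -> section h v' v'' t -> section (g * h) v v'' (s * t).
Proof. by move=> gs ht w; rewrite !actM gs ht. Qed.

Lemma sectionV g v v' s : section g v v' s -> section g^-1 v' v s^-1.
Proof. by move=> gs w; apply: (can_inj (actK g)); rewrite actVK gs actVK. Qed.

Lemma sectionJ g k v v' s t :
  section k v v' s -> section g v v t -> section (g ^ k) v' v' (t ^ s).
Proof.
move=> ks gt; rewrite !conjgE; apply: sectionM; first exact: sectionV.
by apply: sectionM; first exact: gt.
Qed.

Lemma sectionR g h v s t : section g v v s -> section h v v t ->
  section [~ g, h] v v [~ s, t].
Proof.
move=> gs ht; rewrite !commgEl; apply: sectionM; first exact: sectionV.
exact: sectionJ.
Qed.

Lemma section_cat g v v' s u u' t :
  section g v v' s -> section s u u' t -> section g (v ++ u) (v' ++ u') t.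
Proof. by move=> gs st w; rewrite -!catA gs st. Qed.

Definition supported (g : treeAut) (v : seq bool) : Prop :=
  forall w, ~~ prefix v w -> act g w = w.

(** The copy of k below v, an element of the rigid stabilizer of v. *)
Definition planted (v : seq bool) (k g : treeAut) : Prop :=
  section g v v k /\ supported g v.

Lemma planted1 v : planted v 1 1.
Proof. by []. Qed.

Lemma plantedM v k l g h :
  planted v k g -> planted v l h -> planted v (k * l) (g * h).
Proof.
move=> [gk sg] [hl sh]; split; first exact: sectionM hl.
by move=> w vw; rewrite actM sg// sh.
Qed.

Lemma plantedV v k g : planted v k g -> planted v k^-1 g^-1.
Proof.
move=> [gk sg]; split; first exact: sectionV.
by move=> w vw; apply: (can_inj (actK g)); rewrite actVK sg.
Qed.

Lemma prefix_act g v w : prefix (act g v) (act g w) = prefix v w.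
Proof.
suff h (k : treeAut) x y : prefix x y -> prefix (act k x) (act k y).
  by apply/idP/idP => [/(h g^-1)|/h//]; rewrite !actK.
by move=> /prefixP[z ->]; have [z' ->] := act_cat k x z; exact: prefix_prefix.
Qed.

Lemma plantedJ v v' k s g h :
  section h v v' s -> planted v k g -> planted v' (k ^ s) (g ^ h).
Proof.
move=> hs [gk sg]; split; first exact: sectionJ gk.
move=> w v'w; rewrite conjgE !actM sg ?actVK//.
by rewrite -(prefix_act h) actVK (section_act hs).
Qed.

Lemma planted_cat v u k g h :
  planted u k g -> planted v g h -> planted (v ++ u) k h.
Proof.
move=> [gk sg] [hg sh]; split; first exact: section_cat gk.
move=> w vuw; have [/prefixP[w' e]|] := boolP (prefix v w); last exact: sh.
move: vuw; rewrite e hg => vuw; rewrite sg//.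
by apply: contra vuw => /prefixP[x ->]; rewrite catA prefix_prefix.
Qed.

Lemma planted_uniq v k g h : planted v k g -> planted v k h -> g = h.
Proof.
move=> [gk sg] [hk sh]; apply: eq_act => w.
have [/prefixP[w' ->]|vw] := boolP (prefix v w); first by rewrite gk hk.
by rewrite sg// sh.
Qed.

Definition stab1 (g g0 g1 : treeAut) : Prop :=
  section g [:: false] [:: false] g0 /\ section g [:: true] [:: true] g1.

Lemma stab1M g g0 g1 h h0 h1 :
  stab1 g g0 g1 -> stab1 h h0 h1 -> stab1 (g * h) (g0 * h0) (g1 * h1).
Proof. by move=> [? ?] [? ?]; split; apply: sectionM; eassumption. Qed.

Lemma stab1R g g0 g1 h h0 h1 :
  stab1 g g0 g1 -> stab1 h h0 h1 -> stab1 [~ g, h] [~ g0, h0] [~ g1, h1].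
Proof. by move=> [? ?] [? ?]; split; exact: sectionR. Qed.

Lemma section_gen_a b : section gen_a [:: b] [:: ~~ b] 1.
Proof. by []. Qed.

Lemma stab1_conj_a g g0 g1 : stab1 g g0 g1 -> stab1 (g ^ gen_a) g1 g0.
Proof.
move=> [s0 s1]; rewrite -[g0]conjg1 -[g1]conjg1; split.
  exact: sectionJ (section_gen_a true) s1.
exact: sectionJ (section_gen_a false) s0.
Qed.

Definition aif (b : bool) : treeAut := if b then gen_a else 1.

Lemma stab1_spinal x omega : stab1 (gen_spinal x omega)
  (aif (khom (omega 0) x)) (gen_spinal x (shift_seq omega)).
Proof. by rewrite /aif; split=> w //; rewrite /act /=; case: (khom _ _). Qed.

Lemma stab1_eq g h g0 g1 : stab1 g g0 g1 -> stab1 h g0 g1 -> g = h.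
Proof.
move=> [gs0 gs1] [hs0 hs1]; apply: eq_act => -[|[] w]; first by rewrite !act_nil.
  by rewrite -cat1s gs1 hs1.
by rewrite -cat1s gs0 hs0.
Qed.

Lemma planted_true g k : planted [:: true] k g <-> stab1 g 1 k.
Proof.
split=> -[s0 s1]; split=> //.
  by move=> w; rewrite s1.
move=> [|[] w]; rewrite ?act_nil//= ?prefix0s//.
by move=> _; rewrite -cat1s s0.
Qed.

Lemma gen_a2 : gen_a * gen_a = 1.
Proof. by apply: eq_act => w; rewrite actM /act /= flipK. Qed.

Lemma gen_aV : gen_a^-1 = gen_a.
Proof. by apply: mulg1_eq; rewrite gen_a2. Qed.

Lemma gen_spinal0 omega : gen_spinal (false, false) omega = 1.
Proof.
apply: eq_act => w; change (spinal (false, false) omega w = w).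
elim: w omega => [|[] w IH] omega //=; first by rewrite IH.
by rewrite /khom; case: (omega 0) => -[|[|[|//]]].
Qed.

Lemma khomM i x y : khom i (kmul x y) = khom i x (+) khom i y.
Proof. by case: i => [[|[|[|//]]] ?]; case: x y => [[] []] [[] []]. Qed.

Lemma gen_spinalM x y omega :
  gen_spinal x omega * gen_spinal y omega = gen_spinal (kmul x y) omega.
Proof.
apply: eq_act => w; 
change (spinal y omega (spinal x omega w) = spinal (kmul x y) omega w).
elim: w omega => [|[] w IH] omega //=; first by rewrite IH.
by rewrite khomM; case: (khom _ x); case: (khom _ y) => //=; rewrite flipK.
Qed.

Lemma gen_spinal2 x omega : gen_spinal x omega * gen_spinal x omega = 1.
Proof.
by rewrite gen_spinalM; case: x => -[] []; rewrite /kmul /= gen_spinal0.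
Qed.

Lemma gen_spinalV x omega : (gen_spinal x omega)^-1 = gen_spinal x omega.
Proof. by apply: mulg1_eq; rewrite gen_spinal2. Qed.

Lemma gen_spinalC x y omega : commute (gen_spinal x omega) (gen_spinal y omega).
Proof.
by rewrite /commute !gen_spinalM /kmul addbC [in X in (_, X)]addbC.
Qed.

(** * Elements of the Grigorchuk group as words in involutions *)

Section Words.
Variable omega : nat -> 'I_3.

(** [None] codes a. Every letter is an involution or trivial, so that reversed words give the
    inverses. *)
Definition letter (o : option (bool * bool)) : treeAut :=
  if o is Some x then gen_spinal x omega else gen_a.

Definition word (s : seq (option (bool * bool))) : treeAut :=
  foldr (fun o g => letter o * g) 1 s.

Lemma letter2 o : letter o * letter o = 1.
Proof. by case: o => [x|] /=; rewrite ?gen_spinal2 ?gen_a2. Qed.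

Lemma word_cat s t : word (s ++ t) = word s * word t.
Proof. by elim: s => [|o s IH] /=; rewrite ?mul1g// IH mulgA. Qed.

Lemma word_rev s : word (rev s) = (word s)^-1.
Proof.
elim: s => [|o s IH]; first by rewrite invg1.
rewrite rev_cons -cats1 word_cat IH /= invgM mulg1; congr (_ * _).
by apply/esym/mulg1_eq; exact: letter2.
Qed.

Lemma inG1 : grigorchuk_set omega 1.
Proof. by have [/set_mem] := grigorchuk_closed omega. Qed.

Lemma inGF g h : grigorchuk_set omega g -> grigorchuk_set omega h ->
  grigorchuk_set omega (g * h^-1).
Proof.
have [_ GF] := grigorchuk_closed omega => Gg Gh; apply: set_mem.
by apply: GF; exact: mem_set.
Qed.

Lemma inGV g : grigorchuk_set omega g -> grigorchuk_set omega g^-1.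
Proof. by move=> Gg; rewrite -[g^-1]mul1g; apply: inGF => //; exact: inG1. Qed.

Lemma inGM g h : grigorchuk_set omega g -> grigorchuk_set omega h ->
  grigorchuk_set omega (g * h).
Proof. by move=> Gg Gh; rewrite -[h]invgK; apply: inGF => //; exact: inGV. Qed.

Lemma inGJ g h : grigorchuk_set omega g -> grigorchuk_set omega h ->
  grigorchuk_set omega (g ^ h).
Proof. by move=> Gg Gh; rewrite conjgE; apply: inGM; [exact: inGV|exact: inGM]. Qed.

Lemma inGR g h : grigorchuk_set omega g -> grigorchuk_set omega h ->
  grigorchuk_set omega [~ g, h].
Proof. by move=> Gg Gh; rewrite commgEl; apply: inGM; [exact: inGV|exact: inGJ]. Qed.

Lemma inG_a : grigorchuk_set omega gen_a.
Proof. by move=> H [_]; apply; do 3 left. Qed.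

Lemma inG_spinal x : grigorchuk_set omega (gen_spinal x omega).
Proof.
case: x => -[] []; last by rewrite gen_spinal0; exact: inG1.
- by move=> H [_]; apply; right.
- by move=> H [_]; apply; left; left; right.
- by move=> H [_]; apply; left; right.
Qed.

Lemma inG_word s : grigorchuk_set omega (word s).
Proof.
elim: s => [|[x|] s IH] /=; first exact: inG1; apply: inGM => //.
  exact: inG_spinal.
exact: inG_a.
Qed.

Lemma inG_wordP g : grigorchuk_set omega g -> exists s, g = word s.
Proof.
move=> /(_ [set g | exists s, g = word s]); apply; split.
  split=> [|h k]; rewrite ?inE; first by exists [::].
  move=> [s ->] [t ->].
  by exists (s ++ rev t); rewrite word_cat word_rev.
move=> h [[[|]|]|] ->; [exists [:: None]|exists [:: Some kb]|
  exists [:: Some kc]|exists [:: Some kd]]; by rewrite /= mulg1.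
Qed.

Lemma grigorchuk_ind (P : treeAut -> Prop) : P 1 ->
  (forall g, grigorchuk_set omega g -> P g -> P (gen_a * g)) ->
  (forall x g, grigorchuk_set omega g -> P g -> P (gen_spinal x omega * g)) ->
  forall g, grigorchuk_set omega g -> P g.
Proof.
move=> P1 Pa Ps g /inG_wordP[s ->]; elim: s => [//|[x|] s IH] /=.
  by apply: Ps => //; exact: inG_word.
by apply: Pa => //; exact: inG_word.
Qed.

End Words.

Lemma planted_false g k : planted [:: false] k g <-> stab1 g k 1.
Proof.
split=> -[s0 s1]; split=> //.
  by move=> w; rewrite s1.
move=> [|[] w]; rewrite ?act_nil//= ?prefix0s//.
by move=> _; rewrite -cat1s s1.
Qed.

(** * The branching subgroups of the Grigorchuk groups *)

Definition shiftn (n : nat) (omega : nat -> 'I_3) : nat -> 'I_3 :=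
  fun i => omega (n + i).

Lemma shift_shiftn n omega : shift_seq (shiftn n omega) = shiftn n.+1 omega.
Proof. by apply/funext => i; rewrite /shift_seq /shiftn addnS. Qed.

Lemma shiftnD m n omega : shiftn m (shiftn n omega) = shiftn (n + m) omega.
Proof. by apply/funext => i; rewrite /shiftn addnA. Qed.

Lemma khom_onto i : exists x, khom i x.
Proof. by case: i => [[|[|[|//]]] ?]; [exists kb|exists kb|exists kc]. Qed.

Lemma inG_section1 omega g b : grigorchuk_set omega g ->
  exists b' s, grigorchuk_set (shift_seq omega) s /\ section g [:: b] [:: b'] s.
Proof.
move=> Gg; elim/grigorchuk_ind: g / Gg b => [b|g _ IH b|x g _ IH b].
- by exists b, 1; split; [exact: inG1|].
- have [b' [s [Gs gs]]] := IH (~~ b); by exists b', s.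
- have [b' [s [Gs gs]]] := IH b; have [s0 s1] := stab1_spinal x omega.
  exists b'; case: b gs => gs.
    exists (gen_spinal x (shift_seq omega) * s); split; last exact: sectionM gs.
    by apply: inGM => //; exact: inG_spinal.
  exists (aif (khom (omega 0) x) * s); split; last exact: sectionM gs.
  by apply: inGM => //; rewrite /aif; case: ifP => _; [exact: inG_a|exact: inG1].
Qed.

Lemma inG_section omega g v : grigorchuk_set omega g ->
  exists2 s, grigorchuk_set (shiftn (size v) omega) s & section g v (act g v) s.
Proof.
elim: v omega g => [|b v IH] omega g Gg.
  by exists g => // w; rewrite act_nil.
have [b' [s [Gs gs]]] := inG_section1 b Gg.
have [t Gt st] := IH _ _ Gs; exists t => //.
by rewrite -cat1s gs; exact: section_cat st.
Qed.

(** Self-replication. At the vertex 1, the section of x is its own shift, and the section of x^a is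
    a as soon as omega_0 does not kill x; conjugation by a exchanges the two vertices. *)
Lemma inG_lift1 omega s b : grigorchuk_set (shift_seq omega) s ->
  exists2 g, grigorchuk_set omega g & section g [:: b] [:: b] s.
Proof.
move=> Gs; suff [g Gg [g0 [gs0 gs1]]] : exists2 g, grigorchuk_set omega g &
    exists g0, stab1 g g0 s.
  case: b; first by exists g.
  exists (g ^ gen_a); first by apply: inGJ => //; exact: inG_a.
  by have [] := stab1_conj_a (conj gs0 gs1).
elim/grigorchuk_ind: s / Gs => [|s _ [g Gg [g0 gs]]|x s _ [g Gg [g0 gs]]].
- by exists 1; [exact: inG1|exists 1].
- have [x ax] := khom_onto (omega 0).
  have := stab1_conj_a (stab1_spinal x omega); rewrite ax /= => xs.
  exists (gen_spinal x omega ^ gen_a * g).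
    by apply: inGM => //; apply: inGJ; [exact: inG_spinal|exact: inG_a].
  by exists (gen_spinal x (shift_seq omega) * g0); exact: stab1M.
- exists (gen_spinal x omega * g).
    by apply: inGM => //; exact: inG_spinal.
  exists (aif (khom (omega 0) x) * g0).
  by apply: stab1M => //; exact: stab1_spinal.
Qed.

Lemma inG_lift omega v s : grigorchuk_set (shiftn (size v) omega) s ->
  exists2 g, grigorchuk_set omega g & section g v v s.
Proof.
elim: v omega s => [|b v IH] omega s Gs; first by exists s.
have [t Gt ts] := IH (shift_seq omega) s Gs.
have [g Gg gt] := inG_lift1 b Gt; exists g => //.
by rewrite -cat1s; exact: section_cat ts.
Qed.

(** Level transitivity: self-replication adjusts the tail while fixing the first letter, then a
    adjusts the first letter. *)
Lemma inG_trans omega u v : size u = size v ->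
  exists2 g, grigorchuk_set omega g & act g u = v.
Proof.
elim: u v omega => [|b u IH] [|b' v] //= omega.
  by move=> _; exists 1; [exact: inG1|].
move=> [/(IH _ (shift_seq omega)) [s Gs sv]].
have [g Gg gs] := inG_lift1 b Gs.
have [<-|bb'] := eqVneq b b'; first by exists g => //; rewrite -cat1s gs sv.
exists (g * gen_a); first by apply: inGM => //; exact: inG_a.
rewrite actM -cat1s gs sv /act /=; congr (_ :: _).
by case: b b' bb' {gs} => [] [].
Qed.

(** The non-trivial element of the kernel of the homomorphism i. *)
Definition killed (i : 'I_3) : klein :=
  match val i with 0 => kd | 1 => kc | _ => kb end.

Lemma khom_killed i : khom i (killed i) = false.
Proof. by case: i => [[|[|[|//]]] ?]. Qed.

Lemma killed_neq0 i : killed i != (false, false).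
Proof. by case: i => [[|[|[|//]]] ?]. Qed.

Lemma khom_eq0 i x : x != (false, false) -> khom i x = false -> x = killed i.
Proof. by case: i => [[|[|[|//]]] ?]; case: x => -[] []. Qed.

(** The normal closure of [a, z] in G_omega, as an inductive predicate so as to argue by induction
    on its elements. *)
Inductive inK (z : klein) (omega : nat -> 'I_3) : treeAut -> Prop :=
| inK1 : inK z omega 1
| inK_gen : inK z omega [~ gen_a, gen_spinal z omega]
| inKM g h of inK z omega g & inK z omega h : inK z omega (g * h)
| inKV g of inK z omega g : inK z omega g^-1
| inKJ g h of inK z omega g & grigorchuk_set omega h : inK z omega (g ^ h).

Definition normal_in (omega : nat -> 'I_3) (Q : treeAut -> Prop) : Prop :=
  [/\ Q 1, forall g h, Q g -> Q h -> Q (g * h), forall g, Q g -> Q g^-1 &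
      forall g h, Q g -> grigorchuk_set omega h -> Q (g ^ h)].

Lemma inK_normal z omega : normal_in omega (inK z omega).
Proof. by split; [exact: inK1|exact: inKM|exact: inKV|exact: inKJ]. Qed.

Lemma inK_inG z omega g : inK z omega g -> grigorchuk_set omega g.
Proof.
elim=> {g} [||g h _ Gg _ Gh|g _ Gg|g h _ Gg Gh].
- exact: inG1.
- by apply: inGR; [exact: inG_a|exact: inG_spinal].
- exact: inGM.
- exact: inGV.
- exact: inGJ.
Qed.

Lemma normal_inF omega Q g h : normal_in omega Q -> Q g -> Q h -> Q (g * h^-1).
Proof. by move=> [_ QM QV _] Qg Qh; apply: QM => //; exact: QV. Qed.

Lemma normal_inRr omega Q g h : normal_in omega Q ->
  grigorchuk_set omega g -> Q h -> Q [~ g, h].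
Proof.
move=> [_ QM QV QJ] Gg Qh; rewrite commgEr; apply: QM => //.
by apply: QJ => //; exact: QV.
Qed.

Lemma normal_inRl omega Q g h : normal_in omega Q ->
  Q g -> grigorchuk_set omega h -> Q [~ g, h].
Proof.
move=> [_ QM QV QJ] Qg Gh; rewrite commgEl; apply: QM; first exact: QV.
exact: QJ.
Qed.

(** One planted conjugate of the generator [a, y] suffices: by self-replication the conjugations of
    the group at v lift to conjugations in G, which preserve Q, and level transitivity moves v to
    u. *)
Lemma spread_inK omega Q y u v g h : normal_in omega Q -> size u = size v ->
  Q g -> grigorchuk_set (shiftn (size v) omega) h ->
  planted v ([~ gen_a, gen_spinal y (shiftn (size v) omega)] ^ h) g ->
  forall k, inK y (shiftn (size v) omega) k -> exists2 g', Q g' & planted u k g'.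
Proof.
move=> NQ uv Qg Gh gv; have [Q1 QM QV QJ] := NQ.
suff Kv k : inK y (shiftn (size v) omega) k -> exists2 g', Q g' & planted v k g'.
  have [t Gt tv] := inG_trans omega (esym uv).
  have [s Gs ts] := inG_section v Gt; rewrite tv in ts.
  move=> k Kk; have /Kv[g' Qg' g'k] : inK y (shiftn (size v) omega) (k ^ s^-1).
    by apply: inKJ => //; exact: inGV.
  exists (g' ^ t); first exact: QJ.
  by rewrite -[k](conjgKV s); exact: plantedJ ts g'k.
have lift h' : grigorchuk_set (shiftn (size v) omega) h' ->
  forall k, (exists2 g', Q g' & planted v k g') ->
  exists2 g', Q g' & planted v (k ^ h') g'.
  move=> Gh' {}k [g' Qg' g'k]; have [t Gt th'] := inG_lift Gh'.
  by exists (g' ^ t); [exact: QJ|exact: plantedJ g'k].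
elim=> {k} [||k l _ [g' Qg' g'k] _ [g'' Qg'' g''l]|k _ [g' Qg' g'k]|k l _ IH Gl].
- by exists 1 => //; exact: planted1.
- by rewrite -[[~ _, _]](conjgK h); apply: lift; [exact: inGV|exists g].
- by exists (g' * g''); [exact: QM|exact: plantedM].
- by exists g'^-1; [exact: QV|exact: plantedV].
- exact: lift.
Qed.

Lemma stab1_comm_a z omega : stab1 [~ gen_a, gen_spinal z omega]
  (gen_spinal z (shift_seq omega) * aif (khom (omega 0) z))
  (aif (khom (omega 0) z) * gen_spinal z (shift_seq omega)).
Proof.
have zs := stab1_spinal z omega.
by rewrite commgEr gen_spinalV; apply: stab1M => //; exact: stab1_conj_a.
Qed.

Lemma commMgC (g h x : treeAut) : commute h x -> [~ g * h, x] = [~ g, x] ^ h.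
Proof.
move=> hx; rewrite !commgEl conjMg (_ : h ^ x = h).
  by rewrite invgM [RHS]conjgE !mulgA.
by rewrite conjgE hx mulKg.
Qed.

(* With z' the section of z at true and x_0 = killed (omega 0): if z acts by a
   at false, then [[a, z], x_0] = (1, [a, x_0']^z'); otherwise z = x_0 and
   [x, [a, z]] = ([a, z'], 1) for any x acting by a at false. *)
Lemma inK_lift1 z omega : z != (false, false) -> forall b k,
  inK (killed (omega 0)) (shift_seq omega) k ->
  exists2 g, inK z omega g & planted [:: b] k g.
Proof.
move=> z0 b; have NK := inK_normal z omega; set y := killed _.
have zs := stab1_comm_a z omega; case zE : (khom (omega 0) z) zs => /= zs.
  have := stab1_spinal y omega; rewrite /y khom_killed /= -/y => ys.
  have := stab1R zs ys; rewrite commg1 => /planted_true.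
  rewrite commMgC; last exact: gen_spinalC.
  apply: (@spread_inK omega _ y [:: b] [:: true] _ _ NK) => //.
    by apply: (normal_inRl NK); [exact: inK_gen|exact: inG_spinal].
  exact: inG_spinal.
have yz : y = z by apply/esym/khom_eq0.
have [x xE] := khom_onto (omega 0).
have := stab1_spinal x omega; rewrite xE /= => xs.
have := stab1R xs zs; rewrite mulg1 mul1g.
rewrite (_ : [~ gen_spinal x (shift_seq omega), _] = 1); last first.
  by apply/eqP/commgP; exact: gen_spinalC.
rewrite -[[~ gen_a, gen_spinal z (shift_seq omega)]]conjg1 yz => /planted_false.
apply: (@spread_inK omega _ z [:: b] [:: false] _ _ NK) => //.
  apply: (normal_inRr NK); first exact: inG_spinal.
  exact: inK_gen.
exact: inG1.
Qed.

(** A finite labelling of P whose fibres lie in right cosets of Q. This covers predicates on one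
    ambient group and composes easily along chains of subgroups. *)
Definition finite_index_in (G : groupType) (P Q : G -> Prop) : Prop :=
  exists (T : finType) (f : G -> T),
    forall x y, P x -> P y -> f x = f y -> Q (x * y^-1).

Definition recurrent (omega : nat -> 'I_3) : Prop :=
  forall i n, exists2 m, (n <= m)%N & omega m = i.

Lemma recurrent_shiftn omega n : recurrent omega -> recurrent (shiftn n omega).
Proof.
move=> rec i m; have [p mp <-] := rec i (n + m)%N.
exists (p - n)%N; first by rewrite leq_subRL// (leq_trans _ mp)// leq_addr.
by rewrite /shiftn subnKC// (leq_trans _ mp)// leq_addr.
Qed.

Lemma killed_onto x : x != (false, false) -> exists i, killed i = x.
Proof.
case: x => -[] [] // _; first by exists ord0.
  by exists (@Ordinal 3 2 isT).
by exists (@Ordinal 3 1 isT).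
Qed.

Lemma khom_neq i j : i != j -> khom i (killed j).
Proof. by case: i j => [[|[|[|//]]] ?] [[|[|[|//]]] ?]. Qed.

Lemma exists_letter_neq (i : 'I_3) : exists j, j != i.
Proof.
have [->|i0] := eqVneq i ord0; first by exists ord_max.
by exists ord0; rewrite eq_sym.
Qed.

Lemma stab1X g g0 g1 n : stab1 g g0 g1 -> stab1 (g ^+ n) (g0 ^+ n) (g1 ^+ n).
Proof.
by move=> gs; elim: n => [//|n IH]; rewrite !expgS; exact: stab1M.
Qed.

Lemma sqr_a_spinal z omega :
  (gen_a * gen_spinal z omega) ^+ 2 = [~ gen_a, gen_spinal z omega].
Proof. by rewrite expg2 commgEl conjgE gen_aV gen_spinalV !mulgA. Qed.

(** The square of a y is [a, y]. If omega_0 kills y, both its sections are the involution y', so (a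
    y)^4 = 1; otherwise they are a y' and its inverse, and the order doubles with each level until y
    is killed. *)
Lemma a_spinal_torsion y omega k : khom (omega k) y = false ->
  exists2 N, (0 < N)%N & (gen_a * gen_spinal y omega) ^+ N = 1.
Proof.
elim: k omega => [|k IH] omega yk.
  exists (2 * 2)%N => //; apply: (@stab1_eq _ _ 1 1) => //.
  rewrite expgnA sqr_a_spinal -[X in stab1 _ X](gen_spinal2 y (shift_seq omega)).
  rewrite -[X in stab1 _ _ X](gen_spinal2 y (shift_seq omega)).
  have := stab1_comm_a y omega; rewrite yk mulg1 mul1g => ys.
  exact: stab1X ys.
have [ya|] := boolP (khom (omega 0) y); last first.
  move=> /negbTE y0; exists (2 * 2)%N => //; apply: (@stab1_eq _ _ 1 1) => //.
  rewrite expgnA sqr_a_spinal -[X in stab1 _ X](gen_spinal2 y (shift_seq omega)).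
  rewrite -[X in stab1 _ _ X](gen_spinal2 y (shift_seq omega)).
  have := stab1_comm_a y omega; rewrite y0 mulg1 mul1g => ys.
  exact: stab1X ys.
have [N N0 yN] := IH (shift_seq omega) yk.
exists (2 * N)%N; first by rewrite muln_gt0.
apply: (@stab1_eq _ _ 1 1) => //; rewrite expgnA sqr_a_spinal.
have := stab1X N (stab1_comm_a y omega); rewrite ya /= yN.
rewrite (_ : _ * gen_a = (gen_a * gen_spinal y (shift_seq omega))^-1).
  by rewrite expVgn yN invg1.
by rewrite invgM gen_aV gen_spinalV.
Qed.

Lemma mulgVKA (G : groupType) (g t s r : G) :
  g * t^-1 * (t * s * r) = g * s * r.
Proof. by rewrite !mulgA mulgVK. Qed.

(* Modulo K the element z is central, so G is covered by the cosets of the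
   elements (a y)^j a^l z^i, and a y has finite order. *)
Lemma finite_index_inK z omega : z != (false, false) -> recurrent omega ->
  finite_index_in (grigorchuk_set omega) (inK z omega).
Proof.
move=> z0 rec; have NK := inK_normal z omega; have [K1 KM KV KJ] := NK.
pose y := if z == kb then kc else kb.
have [i iy] : exists i, killed i = y by apply: killed_onto; rewrite /y; case: ifP.
have [k _ ki] := rec i 0%N.
have [N N0 ayN] : exists2 N, (0 < N)%N & (gen_a * gen_spinal y omega) ^+ N = 1.
  by apply: (@a_spinal_torsion _ _ k); rewrite ki -iy khom_killed.
pose sz := gen_spinal z omega; pose sy := gen_spinal y omega.
pose b2 (g : treeAut) (b : bool) := if b then g else 1.
pose t j l i := (gen_a * sy) ^+ j * aif l * b2 sz i.
pose R (g : treeAut) := exists j l i, inK z omega (g * (t j l i)^-1).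
have Gsy : grigorchuk_set omega sy by exact: inG_spinal.
have Ga : grigorchuk_set omega gen_a by exact: inG_a.
have Gt j l : grigorchuk_set omega ((gen_a * sy) ^+ j * aif l).
  apply: inGM; last by rewrite /aif; case: ifP => // _; exact: inG1.
  elim: j => [|j IH]; first exact: inG1.
  by rewrite expgS; apply: inGM => //; exact: inGM.
have RM g s j l i' j' l' i'' : inK z omega (g * (t j l i')^-1) ->
    inK z omega (t j l i' * s * (t j' l' i'')^-1) -> R (g * s).
  move=> Kg Ks; exists j', l', i''; have := KM _ _ Kg Ks.
  by rewrite mulgVKA.
have RM1 g s j l i' j' l' i'' : inK z omega (g * (t j l i')^-1) ->
    t j l i' * s = t j' l' i'' -> R (g * s).
  by move=> Kg e; apply: (RM _ _ _ _ _ j' l' i'' Kg); rewrite e mulgV.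
have Ra g : R g -> R (g * gen_a).
  move=> [j [l [i' Kg]]]; apply: (RM _ _ _ _ _ j (~~ l) i' Kg).
  rewrite /t; set u := _ ^+ _.
  have -> : aif (~~ l) = aif l * gen_a by case: l {Kg}; rewrite /= ?gen_a2 ?mul1g.
  have -> : u * aif l * b2 sz i' * gen_a * (u * (aif l * gen_a) * b2 sz i')^-1 =
      [~ (b2 sz i')^-1, gen_a^-1] ^ (u * aif l)^-1.
    by rewrite !commgEl !conjgE !invgM !invgK !mulgA.
  apply: KJ; last by apply: inGV; exact: Gt.
  case: i' {Kg}; rewrite /= ?invg1 ?comm1g// gen_spinalV gen_aV.
  by rewrite -invgR; apply: KV; exact: inK_gen.
have Ry g : R g -> R (g * sy).
  move=> [j [l [i' Kg]]].
  have e : b2 sz i' * sy = sy * b2 sz i'.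
    by case: i' {Kg}; rewrite /= ?mulg1 ?mul1g//; exact: gen_spinalC.
  move: Kg; case: l => Kg.
    apply: (RM1 _ _ _ _ _ j.+1 false i' Kg).
    by rewrite /t -mulgA e /= !mulgA mulg1 expgSr !mulgA.
  apply: (RM1 _ _ _ _ _ (j + N.-1)%N true i' Kg).
  rewrite /t -mulgA e /= !mulgA mulg1; congr (_ * _).
  rewrite expgnDr -mulgA; congr (_ * _).
  apply: (mulgI (gen_a * sy)); rewrite mulgA -expgS prednK// ayN mul1g -mulgA.
  by rewrite gen_spinal2 mulg1.
have Rz g : R g -> R (g * sz).
  move=> [j [l [i' Kg]]]; apply: (RM1 _ _ _ _ _ j l (~~ i') Kg).
  rewrite /t -mulgA; congr (_ * _).
  by case: i' {Kg}; rewrite /= ?mul1g ?gen_spinal2.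
have Rs x g : R g -> R (g * gen_spinal x omega).
  move=> Rg.
  have : x \in [:: (false, false); y; z; kmul y z].
    by rewrite /y; case: (z) z0 => -[] [] //; case: x => -[] [].
  rewrite !inE => /or4P[] /eqP ->.
  - by rewrite gen_spinal0 mulg1.
  - exact: Ry.
  - exact: Rz.
  - by rewrite -gen_spinalM mulgA; apply: Rz; exact: Ry.
(* [R] is stable under right multiplication by generators while the induction multiplies on the
   left, hence the inverse. *)
have Rall g : grigorchuk_set omega g -> R g^-1.
  elim/grigorchuk_ind => [|{}g _ Rg|x {}g _ Rg].
  - by exists 0%N, false, false; rewrite /t /= expg0 !mulg1 invg1 mulg1.
  - by rewrite invgM gen_aV; exact: Ra.
  - by rewrite invgM gen_spinalV; exact: Rs.
have tmod j l i' : t j l i' = t (j %% N)%N l i'.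
  rewrite /t; congr (_ * _ * _); rewrite {1}(divn_eq j N) expgnDr mulnC.
  by rewrite expgnA ayN expg1n mul1g.
have /choice[f fP] : forall g, exists x : 'I_N * bool * bool,
    grigorchuk_set omega g -> inK z omega (g * (t x.1.1 x.1.2 x.2)^-1).
  move=> g; have [Gg|nG] := pselect (grigorchuk_set omega g); last first.
    by exists (Ordinal N0, false, false).
  have [j [l [i' Kg]]] := Rall _ (inGV Gg).
  exists (Ordinal (ltn_pmod j N0), l, i') => _ /=.
  by move: Kg; rewrite (invgK g) tmod.
exists ('I_N * bool * bool)%type, f => g h Gg Gh fgh.
have := normal_inF NK (fP _ Gg) (fP _ Gh).
by rewrite fgh invgF mulgA mulgVK.
Qed.

Lemma section_spinal x omega n :
  section (gen_spinal x omega) (nseq n true) (nseq n true)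
    (gen_spinal x (shiftn n omega)).
Proof.
elim: n omega => [//|n IH] omega w.
rewrite -[nseq n.+1 true]/([:: true] ++ nseq n true).
have [_ s1] := stab1_spinal x omega.
by rewrite -catA s1 IH.
Qed.

(** As [a, z] = (a z)^2, the section at 1 of [a, z]^(2^j) is [a, z']^(2^(j-1)) while z acts as a;
    when z is killed, the section of [a, z] is z' itself. *)
Lemma section_sqr_power z omega j :
  (forall i, (i < j)%N -> khom (omega i) z) -> khom (omega j) z = false ->
  section ([~ gen_a, gen_spinal z omega] ^+ (2 ^ j)) (nseq j.+1 true)
    (nseq j.+1 true) (gen_spinal z (shiftn j.+1 omega)).
Proof.
elim: j omega => [|j IH] omega zj zE.
  by have [] := stab1_comm_a z omega; rewrite zE mul1g expg1.
have [_] := stab1X (2 ^ j.+1) (stab1_comm_a z omega); rewrite zj //= => s1.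
have {}IH := IH (shift_seq omega) (fun i ij => zj i.+1 ij) zE.
have e : (gen_a * gen_spinal z (shift_seq omega)) ^+ (2 ^ j.+1) =
    [~ gen_a, gen_spinal z (shift_seq omega)] ^+ (2 ^ j).
  by rewrite expnS expgnA sqr_a_spinal.
rewrite e in s1.
exact: section_cat s1 IH.
Qed.

Lemma inKX z omega g n : inK z omega g -> inK z omega (g ^+ n).
Proof. by move=> Kg; elim: n => [|n IH]; rewrite ?expgS; [exact: inK1|exact: inKM]. Qed.

(** Provides an element of K that behaves like z far along the ray 1^oo. The exponent comes from the
    first level that kills z. *)
Lemma inK_spinal_section z omega : z != (false, false) -> recurrent omega ->
  exists2 g, inK z omega g & exists j, forall n, (j <= n)%N ->
    section g (nseq n true) (nseq n true) (gen_spinal z (shiftn n omega)).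
Proof.
move=> z0 rec; have [i iz] := killed_onto z0.
have ex : exists j, khom (omega j) z == false.
  by have [j _ ji] := rec i 0%N; exists j; rewrite ji -iz khom_killed.
case: (ex_minnP ex) => j /eqP zj jmin.
exists ([~ gen_a, gen_spinal z omega] ^+ (2 ^ j)).
  by apply: inKX; exact: inK_gen.
exists j.+1 => n jn; rewrite -(subnKC jn) nseqD.
apply: (@section_cat _ (nseq j.+1 true) (nseq j.+1 true)).
  apply: section_sqr_power zj => i' i'j; apply/negPn/negP => /negbTE /eqP /jmin.
  by rewrite leqNgt i'j.
by rewrite -shiftnD; exact: section_spinal.
Qed.

Lemma inK_moves z omega : z != (false, false) -> recurrent omega ->
  exists m, forall u, size u = m -> exists2 k, inK z omega k & act k u <> u.
Proof.
move=> z0 rec; have [g Kg [j gs]] := inK_spinal_section z0 rec.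
have [i iz] := killed_onto z0.
have [i' i'i] := exists_letter_neq i.
have [n jn ni] := rec i' j.
(* The section z at 1^n acts as a below the letter 0, since omega_n does not kill z; so the second
   letter 0 is flipped. *)
pose u0 := nseq n true ++ [:: false; false].
exists (size u0) => u /esym /(inG_trans omega)[h Gh <-].
exists (g ^ h); first exact: inKJ.
rewrite !conjgE !actM actK => /(can_inj (actK h)).
rewrite (gs _ jn) => /eqP; rewrite eqseq_cat// => /andP[_].
rewrite /act /= /shiftn addn0 ni -iz khom_neq//.
Qed.

Inductive inKd (z : klein) (omega : nat -> 'I_3) : treeAut -> Prop :=
| inKd1 : inKd z omega 1
| inKdR g h of inK z omega g & inK z omega h : inKd z omega [~ g, h]
| inKdM g h of inKd z omega g & inKd z omega h : inKd z omega (g * h)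
| inKdV g of inKd z omega g : inKd z omega g^-1.

Lemma inKd_normal z omega : normal_in omega (inKd z omega).
Proof.
split; [exact: inKd1|exact: inKdM|exact: inKdV|].
move=> g h Kg Gh; elim: Kg => {g} [|g k Kg Kk|g k _ IHg _ IHk|g _ IH].
- by rewrite conj1g; exact: inKd1.
- by rewrite conjRg; apply: inKdR; exact: inKJ.
- by rewrite conjMg; exact: inKdM.
- by rewrite conjVg; exact: inKdV.
Qed.

Lemma inK_lift z omega v k : z != (false, false) -> v != [::] ->
  inK (killed (omega (size v).-1)) (shiftn (size v) omega) k ->
  exists2 g, inK z omega g & planted v k g.
Proof.
elim: v z omega k => [//|b [|c v] IH] z omega k z0 _ Kk; first exact: inK_lift1.
have [t Kt tk] := IH (killed (omega 0)) (shift_seq omega) k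
  (killed_neq0 _) isT Kk.
have [g Kg gt] := inK_lift1 z0 b Kt.
by exists g => //; rewrite -cat1s; exact: planted_cat gt.
Qed.

Lemma plantedR v k s g h : planted v k g -> section h v v s ->
  planted v [~ k, s] [~ g, h].
Proof.
move=> gk hs; rewrite !commgEl; apply: plantedM; first exact: plantedV.
exact: plantedJ gk.
Qed.

(* Choose n with z killed by omega_n but not by omega_(n-1), large enough for
   some g in K to have section z at v = 1^n, and let h in K be the copy of
   [a, y] below v, where y = killed (omega (n-1)). As omega_n kills z and not
   y, [h, g] is, up to conjugation, the copy of [a, z'] below v1. *)
Lemma inKd_lift z omega : z != (false, false) -> recurrent omega ->
  exists n, forall u, size u = n.+1 -> forall k,
    inK (killed (omega n)) (shiftn n.+1 omega) k ->
    exists2 g, inKd z omega g & planted u k g.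
Proof.
move=> z0 rec; have [g Kg [j gs]] := inK_spinal_section z0 rec.
have [i iz] := killed_onto z0.
have [i' i'i] := exists_letter_neq i.
have [p jp pi'] := rec i' j.
have ex : exists n, (p < n)%N && (omega n == i).
  by have [n pn ni] := rec i p.+1; exists n; rewrite pn ni eqxx.
case: (ex_minnP ex) => n /andP[pn /eqP ni] nmin.
have n0 : (0 < n)%N by rewrite (leq_trans _ pn).
have ni' : omega n.-1 != i.
  apply/negP => ni'; suff : (n <= n.-1)%N by rewrite leqNgt prednK// leqnn.
  apply: nmin; rewrite ni' andbT; move: (pn); rewrite -[X in (p < X)%N]prednK//.
  rewrite ltnS leq_eqVlt => /orP[/eqP pn'|//].
  by move: i'i; rewrite -pi' pn' ni'.
pose v := nseq n true; have sv : size v = n by rewrite size_nseq.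
pose w := shiftn n omega; pose y := killed (omega n.-1).
have w0 : w 0 = i by rewrite /w /shiftn addn0.
have [h Kh hv] : exists2 h, inK z omega h & planted v [~ gen_a, gen_spinal y w] h.
  apply: inK_lift => //; first by rewrite -size_eq0 sv -lt0n.
  by rewrite sv; exact: inK_gen.
have hgv := plantedR hv (gs _ (leq_trans jp (ltnW pn))).
have ys := stab1_comm_a y w; rewrite w0 khom_neq 1?eq_sym//= in ys.
have zi : khom i z = false by rewrite -iz khom_killed.
have zs := stab1_spinal z w; rewrite w0 zi /= in zs.
have := stab1R ys zs; rewrite commg1 commMgC; last exact: gen_spinalC.
move=> /planted_true hgt; have {hgt} := planted_cat hgt hgv.
rewrite /w !shift_shiftn => hgt.
exists n => u su; rewrite ni iz.
have sv1 : size (v ++ [:: true]) = n.+1 by rewrite size_cat sv addn1.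
have := @spread_inK omega (inKd z omega) z u (v ++ [:: true]).
rewrite sv1; apply; [exact: inKd_normal|by []|
  |by exact: inG_spinal|exact: hgt].
exact: inKdR.
Qed.

(** * Contraction and germs of elements *)

Definition nucleus (omega : nat -> 'I_3) (s : treeAut) : Prop :=
  s = gen_a \/ exists x, s = gen_spinal x omega.

Lemma nucleus_section omega s b : nucleus omega s ->
  exists b' t, section s [:: b] [:: b'] t /\ nucleus (shift_seq omega) t.
Proof.
have nu1 w : nucleus w 1 by right; exists (false, false); rewrite gen_spinal0.
move=> [->|[x ->]]; first by exists (~~ b), 1.
have [s0 s1] := stab1_spinal x omega; exists b; case: b.
  by exists (gen_spinal x (shift_seq omega)); split=> //; right; exists x.
exists (aif (khom (omega 0) x)); split=> //.
by rewrite /aif; case: ifP => _; [left|].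
Qed.

Lemma nucleus_mul omega s t b : nucleus omega s -> nucleus omega t ->
  exists b' r, section (s * t) [:: b] [:: b'] r /\ nucleus (shift_seq omega) r.
Proof.
have nu1 w : nucleus w 1 by right; exists (false, false); rewrite gen_spinal0.
move=> [->|[x ->]] [->|[y ->]].
- by rewrite gen_a2; exists b, 1; split=> //; exact: section1.
- have [b' [r [sr nr]]] : exists b' r, section (gen_spinal y omega) [:: ~~ b]
      [:: b'] r /\ nucleus (shift_seq omega) r.
    by apply: nucleus_section; right; exists y.
  by exists b', r.
- have [b' [r [sr nr]]] : exists b' r, section (gen_spinal x omega) [:: b]
      [:: b'] r /\ nucleus (shift_seq omega) r.
    by apply: nucleus_section; right; exists x.
  exists (~~ b'), r; split=> [|//]; rewrite -[r]mulg1.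
  exact: sectionM sr (section_gen_a b').
- by rewrite gen_spinalM; apply: nucleus_section; right; eexists.
Qed.

Lemma nucleus_sections omega s v : nucleus omega s ->
  exists v' t, section s v v' t /\ nucleus (shiftn (size v) omega) t.
Proof.
elim: v omega s => [|b v IH] omega s ns.
  by exists [::], s; split=> // w.
have [b' [t [st nt]]] := nucleus_section b ns.
have [v' [r [tr nr]]] := IH _ _ nt.
exists (b' :: v'), r; split=> //.
by rewrite -[b :: v]cat1s -[b' :: v']cat1s; exact: section_cat tr.
Qed.

(** Each letter of a word for g costs one level: a product of two elements of the nucleus has its
    sections at single letters in the nucleus. *)
Lemma contracting omega g : grigorchuk_set omega g -> exists n, forall v,
  size v = n -> exists v' s, section g v v' s /\ nucleus (shiftn n omega) s.
Proof.
have step s h : nucleus omega s ->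
    (exists n, forall v, size v = n ->
      exists v' s, section h v v' s /\ nucleus (shiftn n omega) s) ->
    exists n, forall v, size v = n ->
      exists v' t, section (s * h) v v' t /\ nucleus (shiftn n omega) t.
  move=> ns [n hn]; exists n.+1; case/lastP => // v b; rewrite size_rcons.
  move=> [vn]; have [v' [t [st nt]]] := nucleus_sections v ns.
  rewrite vn in nt; have v'n : size v' = n by rewrite -(section_act st) size_act.
  have [v'' [r [hr nr]]] := hn _ v'n.
  have [b' [q [trq nq]]] := nucleus_mul b nt nr.
  exists (v'' ++ [:: b']), q; split; last by rewrite -shift_shiftn.
  by rewrite -cats1; apply: section_cat trq; exact: sectionM hr.
move=> Gg; elim/grigorchuk_ind: g / Gg => [|g _ IH|x g _ IH].
- exists 0 => v _; exists v, 1; split=> //.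
  by right; exists (false, false); rewrite gen_spinal0.
- by apply: step => //; left.
- by apply: step => //; right; exists x.
Qed.

(** The three behaviours of g near a fixed vertex v, according to its section there: trivial, a, or
    spinal. In the last case S is the set of k such that g acts as a below v1^k0; elsewhere off the
    ray v1^oo it is trivial. *)
Definition germ_at (T : Type) (actT : T -> seq bool -> seq bool)
    (g : T) (v : seq bool) (S : pred nat) : Prop :=
  [\/ forall w, actT g (v ++ w) = v ++ w,
      forall b, actT g (v ++ [:: b]) <> v ++ [:: b] |
      (forall m, exists2 k, (m <= k)%N & S k) /\
        forall k, let u := v ++ nseq k true in
          if S k then forall b, actT g (u ++ [:: false; b]) <> u ++ [:: false; b]
          else forall w, actT g (u ++ false :: w) = u ++ false :: w].

(** The sections at the contraction level lie in the nucleus. A non-trivial x is killed by a single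
    letter, and another letter recurs, so S is infinite. *)
Lemma grigorchuk_germ omega g : recurrent omega -> grigorchuk_set omega g ->
  exists n, forall v, size v = n -> act g v = v ->
    exists S, germ_at act g v S.
Proof.
move=> rec Gg; have [n gn] := contracting Gg; exists n => v vn gv.
have [v' [s [gs ns]]] := gn _ vn.
have {}gv : v' = v by rewrite -(section_act gs).
rewrite {v'}gv in gs.
case: ns => [sE|[x sE]]; rewrite {s}sE in gs.
  exists pred0; apply: Or32 => b; rewrite gs => /eqP; rewrite eqseq_cat// eqxx /=.
  by rewrite /act /=; case: b.
have [xE|x0] := eqVneq x (false, false).
  by exists pred0; apply: Or31 => w; rewrite gs xE gen_spinal0.
exists (fun k => khom (omega (n + k)%N) x); apply: Or33; split.
  move=> m; have [i ix] := killed_onto x0.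
  have [i' i'i] := exists_letter_neq i.
  have [p mp pi'] := rec i' (n + m)%N.
  have np : (n <= p)%N by rewrite (leq_trans _ mp)// leq_addr.
  exists (p - n)%N; first by rewrite leq_subRL.
  by rewrite subnKC// pi' -ix khom_neq.
move=> k u; have gk := section_cat gs (@section_spinal x (shiftn n omega) k).
have [_ gu] := (I, gk); rewrite shiftnD in gk.
have [s0 _] := stab1_spinal x (shiftn (n + k) omega).
rewrite /shiftn addn0 in s0; case: ifP => kx; rewrite kx /= in s0.
  move=> b; rewrite -[[:: false; b]]/([:: false] ++ [:: b]).
  rewrite gk s0 => /eqP; rewrite eqseq_cat// eqxx /= /act /=.
  by case: b.
by move=> w; rewrite -[false :: w]/([:: false] ++ w) gk s0.
Qed.

(* The value at level 0 is an arbitrary non-trivial element. *)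
Definition kz (omega : nat -> 'I_3) (n : nat) : klein :=
  if n is m.+1 then killed (omega m) else kb.

Lemma kz_neq0 omega n : kz omega n != (false, false).
Proof. by case: n => [//|n]; exact: killed_neq0. Qed.

Lemma kzD omega m n : kz (shiftn m omega) n.+1 = kz omega (m + n.+1).
Proof. by rewrite addnS. Qed.

(** Choosing z as [kz] at each level makes these subgroups nested: K_(vu) lies in K_v. *)
Definition Kv (omega : nat -> 'I_3) (v : seq bool) (g : treeAut) : Prop :=
  grigorchuk_set omega g /\
  exists2 k, inK (kz omega (size v)) (shiftn (size v) omega) k & planted v k g.

(** * The branching subgroups attached to vertices *)

Section VertexGroups.
Variable omega : nat -> 'I_3.

Lemma Kv_lift v k : inK (kz omega (size v)) (shiftn (size v) omega) k ->
  exists2 g, Kv omega v g & planted v k g.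
Proof.
case: v => [|b v] Kk.
  have kk : planted [::] k k by split=> // w; rewrite prefix0s.
  by exists k => //; split; [exact: inK_inG Kk|exists k].
have [g Kg gk] := @inK_lift kb omega (b :: v) k isT isT Kk.
by exists g => //; split; [exact: inK_inG Kg|exists k].
Qed.

Lemma Kv1 v : Kv omega v 1.
Proof.
by split; [exact: inG1|exists 1; [exact: inK1|exact: planted1]].
Qed.

Lemma KvF v g h : Kv omega v g -> Kv omega v h -> Kv omega v (g * h^-1).
Proof.
move=> [Gg [k Kk gk]] [Gh [l Kl hl]]; split; first exact: inGF.
exists (k * l^-1); first by apply: inKM => //; exact: inKV.
by apply: plantedM => //; exact: plantedV.
Qed.

Lemma Kv_supported v g : Kv omega v g -> supported g v.
Proof. by move=> [_ [k _ [_]]]. Qed.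

Lemma KvJ v g h : Kv omega v g -> grigorchuk_set omega h ->
  Kv omega (act h v) (g ^ h).
Proof.
move=> [Gg [k Kk gk]] Gh; split; first exact: inGJ.
have [s Gs hs] := inG_section v Gh; exists (k ^ s).
  by rewrite size_act; exact: inKJ.
exact: plantedJ gk.
Qed.

Lemma Kv_cat v u g : Kv omega (v ++ u) g -> Kv omega v g.
Proof.
case: u => [|b u]; first by rewrite cats0.
move=> [Gg [k Kk [gk sg]]]; split=> //.
have [h Kh [hk sh]] : exists2 h, inK (kz omega (size v)) (shiftn (size v) omega) h &
    planted (b :: u) k h.
  apply: inK_lift => //; first exact: kz_neq0.
  by move: Kk; rewrite size_cat /= -shiftnD -kzD.
exists h => //; split=> w.
  have [/prefixP[w' ->]|uw] := boolP (prefix (b :: u) w).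
    by rewrite catA gk hk catA.
  rewrite sh// sg//; apply: contra uw => /prefixP[w'].
  by rewrite -catA => /eqP; rewrite eqseq_cat// eqxx => /eqP ->; rewrite prefix_prefix.
move=> vw; rewrite sg//; apply: contra vw => /prefixP[w' ->].
by rewrite -catA prefix_prefix.
Qed.

End VertexGroups.

Definition is_subgroup (G : groupType) (S : G -> Prop) : Prop :=
  S 1 /\ forall x y, S x -> S y -> S (x * y^-1).

Section VertexGroupsRec.
Variable omega : nat -> 'I_3.
Hypothesis rec : recurrent omega.

Lemma Kv_moves v : exists m, forall u, size u = m ->
  exists2 g, Kv omega v g & act g (v ++ u) <> v ++ u.
Proof.
have [m hm] := inK_moves (kz_neq0 omega (size v)) (recurrent_shiftn (size v) rec).
exists m => u /hm[k Kk ku]; have [g Kg [gk _]] := Kv_lift Kk.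
by exists g => //; rewrite gk => /eqP; rewrite eqseq_cat// eqxx => /eqP.
Qed.

(** The derived subgroup of K_v appears through the subgroups S containing its commutators, a form
    that passes unchanged to the abstract setting. *)
Lemma Kv_derived v : exists m, forall u, size u = m ->
  forall S : treeAut -> Prop, is_subgroup S ->
  (forall x y, Kv omega v x -> Kv omega v y -> S [~ x, y]) ->
  forall g, Kv omega (v ++ u) g -> S g.
Proof.
set z := kz omega (size v); set w := shiftn (size v) omega.
have [n hn] := inKd_lift (kz_neq0 omega (size v)) (recurrent_shiftn (size v) rec).
exists n.+1 => u un S [S1 SF] SR g [_ [k Kk gk]].
have SV x : S x -> S x^-1 by move=> Sx; rewrite -[x^-1]mul1g; exact: SF.
have [d Kd dk] : exists2 d, inKd z w d & planted u k d.
  apply: hn => //; move: Kk; rewrite size_cat un -kzD /=.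
  by rewrite -[size v + n.+1]/(size v + n.+1)%N -shiftnD.
suff [g' Sg' g'd] : exists2 g', S g' & planted v d g'.
  by rewrite (planted_uniq gk (planted_cat dk g'd)).
elim: Kd {dk} => {d} [|x y Kx Ky|x y _ [gx Sx xg] _ [gy Sy yg]|x _ [gx Sx xg]].
- by exists 1 => //; exact: planted1.
- have [gx Kgx [gxx sx]] := Kv_lift Kx; have [gy Kgy [gyy sy]] := Kv_lift Ky.
  by exists [~ gx, gy]; [exact: SR|exact: plantedR].
- exists (gx * gy); last exact: plantedM.
  by rewrite -[gy](invgK gy); apply: SF => //; exact: SV.
- by exists gx^-1; [exact: SV|exact: plantedV].
Qed.

(** x is the product of the planted copies of its sections at level n. They are divided out one at a
    time, l listing the vertices whose section may still be non-trivial. *)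
Lemma Kv_generated n (S : treeAut -> Prop) : is_subgroup S ->
  (forall v, size v = n -> forall g, Kv omega v g -> S g) ->
  forall (l : seq (seq bool)) x, (forall v, size v = n ->
    exists2 k, inK (kz omega n) (shiftn n omega) k & section x v v k) ->
  (forall v, size v = n -> v \notin l -> section x v v 1) -> S x.
Proof.
move=> [S1 SF] SK; have SV x : S x -> S x^-1.
  by move=> Sx; rewrite -[x^-1]mul1g; exact: SF.
elim=> [|v l IH] x xK xl.
  rewrite (_ : x = 1)//; apply: eq_act => w; rewrite act1.
  have [wn|nw] := leqP n (size w).
    rewrite -(cat_take_drop n w) (xl (take n w))//.
    by rewrite size_takel.
  have /section_act/(congr1 (take (size w))) : section x (w ++ nseq (n - size w) true)
      (w ++ nseq (n - size w) true) 1.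
    by apply: xl => //; rewrite size_cat size_nseq subnKC// ltnW.
  by rewrite -act_take !take_size_cat.
have [vn|vn] := eqVneq (size v) n; last first.
  apply: IH => // u un ul; apply: xl => //; rewrite inE negb_or ul andbT.
  by apply: contra_neq vn => <-.
have [k Kk xk] := xK v vn; rewrite -{1 2}vn in Kk.
have [g Kg [gk sg]] := Kv_lift Kk.
have gfix u : size u = n -> u != v -> section g u u 1.
  move=> un uv w; apply: sg; apply: contra uv => /prefixP[w'] /eqP.
  by rewrite eqseq_cat ?un ?vn// => /andP[].
rewrite -[x](mulgVK g) -[X in _ * X]invgK; apply: SF; last first.
  by apply: SV; exact: SK vn _ Kg.
apply: IH => u un.
  have [->|uv] := eqVneq u v.
    exists (k * k^-1); last by apply: sectionM => //; exact: sectionV.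
    by rewrite mulgV; exact: inK1.
  have [l' Kl xl'] := xK u un; exists (l' * 1^-1); first by rewrite invg1 mulg1.
  by apply: sectionM => //; apply: sectionV; exact: gfix.
have [->|uv] := eqVneq u v => ul.
  by rewrite -(mulgV k); apply: sectionM => //; exact: sectionV.
rewrite -(mulgV 1); apply: sectionM; first by apply: xl; rewrite // inE negb_or uv.
by apply: sectionV; exact: gfix.
Qed.

(** An element is labelled by its permutation of level n and the classes of its sections modulo K.
    With equal labels, x y^-1 fixes level n and has its sections in K. *)
Lemma Kv_finite_index n (S : treeAut -> Prop) : is_subgroup S ->
  (forall v, size v = n -> forall g, Kv omega v g -> S g) ->
  finite_index_in (grigorchuk_set omega) S.
Proof.
move=> sS SK.
have [T [f fP]] := finite_index_inK (kz_neq0 omega n) (recurrent_shiftn n rec).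
have /choice[sec secP] : forall gv : treeAut * seq bool, exists s,
    grigorchuk_set omega gv.1 ->
    grigorchuk_set (shiftn (size gv.2) omega) s /\
    section gv.1 gv.2 (act gv.1 gv.2) s.
  move=> [g v]; have [Gg|nG] := pselect (grigorchuk_set omega g); last by exists 1.
  by have [s Gs gs] := inG_section v Gg; exists s.
have szP (g : treeAut) (v : n.-tuple bool) : size (act g v) == n.
  by rewrite size_act size_tuple.
exists {ffun n.-tuple bool -> n.-tuple bool * T}.
exists (fun g => [ffun v : n.-tuple bool =>
  (Tuple (szP g v), f (sec (g, tval v)))]) => x y Gx Gy /ffunP xy.
have xyv v : size v = n ->
    exists2 k, inK (kz omega n) (shiftn n omega) k & section (x * y^-1) v v k.
  move=> /eqP vn; have := xy (Tuple vn); rewrite !ffunE => -[axy fxy].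
  have [/= Gs xs] := secP (x, v) Gx; have [/= Gt yt] := secP (y, v) Gy.
  rewrite (eqP vn) in Gs Gt; exists (sec (x, v) * (sec (y, v))^-1).
    exact: fP.
  by apply: sectionM; [exact: xs|rewrite axy; exact: sectionV].
apply: (@Kv_generated n S sS SK (map val (enum {: n.-tuple bool})) _ xyv).
move=> v /eqP vn; suff -> : v \in map val (enum {: n.-tuple bool}) by [].
by apply/mapP; exists (Tuple vn) => //; rewrite mem_enum.
Qed.

End VertexGroupsRec.

(* K v is meant to be a copy below v of a branching subgroup. *)
Record branching (G : groupType) (a : G -> seq bool -> seq bool)
    (K : seq bool -> G -> Prop) : Prop := Branching {
  br_countable : exists e : nat -> G, forall g, exists n, e n = g ;
  br_act1 : forall w, a 1 w = w ;
  br_actM : forall g h w, a (g * h) w = a h (a g w) ;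
  br_faithful : forall g, (forall w, a g w = w) -> g = 1 ;
  br_size : forall g w, size (a g w) = size w ;
  br_take : forall g n w, a g (take n w) = take n (a g w) ;
  br_trans : forall u v, size u = size v -> exists g, a g u = v ;
  br_sub : forall v, is_subgroup (K v) ;
  br_supp : forall v g w, K v g -> ~~ prefix v w -> a g w = w ;
  br_conj : forall v g h, K v g -> K (a h v) (g ^ h) ;
  br_cat : forall v u g, K (v ++ u) g -> K v g ;
  br_derived : forall v, exists m, forall u, size u = m ->
    forall S : G -> Prop, is_subgroup S ->
    (forall x y, K v x -> K v y -> S [~ x, y]) -> forall g, K (v ++ u) g -> S g ;
  br_finite : forall n (S : G -> Prop), is_subgroup S ->
    (forall v, size v = n -> forall g, K v g -> S g) ->
    finite_index_in (fun=> True) S ;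
  br_moves : forall v, exists m, forall u, size u = m ->
    exists2 g, K v g & a g (v ++ u) <> v ++ u ;
  br_germ : forall g, exists n, forall v, size v = n -> a g v = v ->
    exists S, germ_at a g v S
}.

Lemma grigorchuk_branching omega : recurrent omega ->
  branching (fun g : grigorchuk omega => act (val g))
    (fun v (g : grigorchuk omega) => Kv omega v (val g)).
Proof.
move=> rec; have inGP (g : grigorchuk omega) : grigorchuk_set omega (val g).
  exact: (set_mem (valP g)).
have ofG g : grigorchuk_set omega g -> exists g' : grigorchuk omega, val g' = g.
  by move=> Gg; exists (Sub g (mem_set Gg)); rewrite SubK.
(* Predicates on the subtype are carried to tree automorphisms, where the results above apply. *)
pose lft (S : grigorchuk omega -> Prop) (x : treeAut) :=
  exists2 g, S g & val g = x.
have lftP (S : grigorchuk omega -> Prop) g : lft S (val g) -> S g.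
  by move=> [g' Sg' /val_inj <-].
have lft_sub (S : grigorchuk omega -> Prop) : is_subgroup S -> is_subgroup (lft S).
  move=> [S1 SF]; split; first by exists 1.
  by move=> _ _ [g Sg <-] [h Sh <-]; exists (g * h^-1); [exact: SF|rewrite gmulfF].
split.
- have /choice[w wP] : forall g : grigorchuk omega, exists s, val g = word omega s.
    by move=> g; apply: inG_wordP; exact: inGP.
  (* Elements are enumerated by the codes of words representing them; integers coding none are sent
     to 1. *)
  exists (fun n => xget 1 [set g | pickle (w g) = n]) => g; exists (pickle (w g)).
  have /= /(pcan_inj pickleK) wg := xgetPex 1
    (ex_intro [set h : grigorchuk omega | pickle (w h) = pickle (w g)] g erefl).
  by apply: val_inj; rewrite !wP wg.
- by move=> w; rewrite val1.
- by move=> g h w; rewrite valM.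
- by move=> g gw; apply: val_inj; rewrite val1; exact: eq_act.
- by move=> g w; rewrite size_act.
- by move=> g n w; rewrite act_take.
- by move=> u v /(inG_trans omega)[_ /ofG[g <-] guv]; exists g.
- move=> v; split; first by rewrite val1; exact: Kv1.
  by move=> x y Kx Ky; rewrite gmulfF; exact: KvF.
- by move=> v g w /Kv_supported; exact.
- by move=> v g h Kg; rewrite gmulfJ; exact: KvJ.
- by move=> v u g; exact: Kv_cat.
- move=> v; have [m hm] := Kv_derived rec v; exists m => u um S sS SR g Kg.
  apply: lftP; apply: (hm u um _ (lft_sub _ sS)) => // x y Kx Ky.
  have [[g' g'x] [h' h'y]] := (ofG _ Kx.1, ofG _ Ky.1); subst x y.
  by exists [~ g', h']; [exact: SR|rewrite gmulfR].
- move=> n S sS SK; have [|T [f fP]] := Kv_finite_index rec (lft_sub _ sS) (n := n).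
    move=> v vn x Kx; have [g gx] := ofG _ Kx.1; subst x.
    by exists g => //; exact: SK vn _ Kx.
  exists T, (f \o val) => x y _ _ fxy; apply: lftP; rewrite gmulfF.
  exact: fP (inGP x) (inGP y) fxy.
- move=> v; have [m hm] := Kv_moves rec v; exists m => u /hm[x Kx xu].
  by have [g gx] := ofG _ Kx.1; subst x; exists g.
- by move=> g; exact: grigorchuk_germ rec (inGP g).
Qed.

Lemma recurrent_Omega' omega : Omega' omega -> recurrent omega.
Proof.
(* Block n+1 starts at position k n, which is at least n because the first block is non-empty, so
   that k > 0. *)
move=> [k hk] i n; have [j [/andP[kj _] <-]] := hk n.+1 isT i.
exists j => //; rewrite (leq_trans _ kj)// subn1 /= leq_pmull//.
by have [j' [/andP[_]]] := hk 1%N isT i; case: (k).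
Qed.

(** * Subgroups of finite index in branching groups *)

(** There are finitely many words of length m; monotonicity lets the largest bound serve for all of
    them. *)
Lemma uniform_words (P : seq bool -> nat -> Prop) m :
  (forall u M M', (M <= M')%N -> P u M -> P u M') ->
  (forall u, size u = m -> exists M, P u M) ->
  exists M, forall u, size u = m -> P u M.
Proof.
elim: m P => [|m IH] P mono h.
  by have [M hM] := h [::] erefl; exists M => u /size0nil ->.
have hb b : exists M, forall u, size u = m -> P (b :: u) M.
  apply: (IH (fun u => P (b :: u))) => [u M M'|u um]; first exact: mono.
  by apply: h; rewrite /= um.
have [[M0 h0] [M1 h1]] := (hb false, hb true).
exists (maxn M0 M1) => -[|[] u] //= [um].
  by apply: (mono _ M1); [exact: leq_maxr|exact: h1].
by apply: (mono _ M0); [exact: leq_maxl|exact: h0].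
Qed.

Section FiniteIndex.
Variable G : groupType.
Implicit Types P Q S : G -> Prop.

Lemma subgroupV S x : is_subgroup S -> S x -> S x^-1.
Proof. by move=> [S1 SF] Sx; rewrite -[x^-1]mul1g; exact: SF. Qed.

Lemma subgroupM S x y : is_subgroup S -> S x -> S y -> S (x * y).
Proof.
move=> sS Sx Sy; rewrite -[y]invgK; apply: (proj2 sS) => //.
exact: subgroupV.
Qed.

Lemma subgroupJ S x y : is_subgroup S -> S x -> S y -> S (x ^ y).
Proof.
move=> sS Sx Sy; rewrite conjgE; apply: subgroupM => //; first exact: subgroupV.
exact: subgroupM.
Qed.

Lemma subgroupR S x y : is_subgroup S -> S x -> S y -> S [~ x, y].
Proof.
move=> sS Sx Sy; rewrite commgEl; apply: subgroupM => //; first exact: subgroupV.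
exact: subgroupJ.
Qed.

Lemma finite_index_inI P Q R : is_subgroup R -> (forall x, R x -> P x) ->
  finite_index_in P Q -> finite_index_in R (fun x => R x /\ Q x).
Proof.
move=> [_ RF] RP [T [f fP]]; exists T, f => x y Rx Ry fxy.
by split; [exact: RF|apply: fP => //; exact: RP].
Qed.

Lemma finite_index_in_trans P Q R : is_subgroup Q -> (forall x, Q x -> P x) ->
  finite_index_in P Q -> finite_index_in Q R -> finite_index_in P R.
Proof.
move=> sQ QP [T [f fP]] [U [g gQ]].
have /choice[r rP] : forall t, exists r, (exists2 x, P x & f x = t) ->
    P r /\ f r = t.
  move=> t; have [[x Px fx]|nx] := pselect (exists2 x, P x & f x = t).
    by exists x.
  by exists 1.
exists (T * U)%type, (fun x => (f x, g (x * (r (f x))^-1))) => x y Px Py.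
move=> [fxy]; have [Pr fr] := rP (f x) (ex_intro2 _ _ x Px erefl).
rewrite -fxy => gxy; rewrite -(mulgKA (r (f x))^-1).
by apply: gQ => //; apply: fP; rewrite // -?fxy.
Qed.

(** The core is the intersection of the conjugates of Q, and x is labelled by the map it induces on
    the classes of f, read on representatives r t. *)
Lemma finite_index_in_core P Q : is_subgroup P -> is_subgroup Q ->
  finite_index_in P Q -> exists N, [/\ is_subgroup N, (forall x, N x -> Q x),
    (forall x y, N x -> P y -> N (x ^ y)) & finite_index_in P N].
Proof.
move=> sP sQ [T [f fP]]; have [[P1 PF] [Q1 QF]] := (sP, sQ).
exists (fun x => forall y, P y -> Q (x ^ y)); split.
- split=> [y _|x x' Nx Nx' y Py]; first by rewrite conj1g.
  by rewrite conjMg conjVg; apply: QF; [exact: Nx|exact: Nx'].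
- by move=> x /(_ 1 P1); rewrite conjg1.
- by move=> x y Nx Py z Pz; rewrite -conjgM; apply: Nx; exact: subgroupM.
have /choice[r rP] : forall t, exists r, (exists2 x, P x & f x = t) ->
    P r /\ f r = t.
  move=> t; have [[x Px fx]|nx] := pselect (exists2 x, P x & f x = t).
    by exists x.
  by exists 1.
exists {ffun T -> T}, (fun x => [ffun t => f (r t * x)]) => x y Px Py.
move=> /ffunP xy z Pz; have PzV : P z^-1 by exact: subgroupV.
have [Pr fr] := rP (f z^-1) (ex_intro2 _ _ _ PzV erefl).
have := xy (f z^-1); rewrite !ffunE => /fP Qr.
have -> : (x * y^-1) ^ z = (z^-1 * (r (f z^-1))^-1) *
    (r (f z^-1) * x * (r (f z^-1) * y)^-1) * (z^-1 * (r (f z^-1))^-1)^-1.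
  by rewrite conjgE !invgM !invgK !mulgA !mulgVK.
apply: QF; last exact: fP.
by apply: subgroupM => //; [exact: fP|apply: Qr; exact: subgroupM].
Qed.

End FiniteIndex.

Section BranchingTheory.
Variables (G : groupType) (a : G -> seq bool -> seq bool).
Variables (K : seq bool -> G -> Prop) (br : branching a K).

Lemma br_actK g : cancel (a g) (a g^-1).
Proof. by move=> w; rewrite -(br_actM br) mulgV (br_act1 br). Qed.

Lemma br_actVK g : cancel (a g^-1) (a g).
Proof. by move=> w; rewrite -(br_actM br) mulVg (br_act1 br). Qed.

Lemma br_prefix g v w : prefix v w -> prefix (a g v) (a g w).
Proof.
move=> /prefixP[u e]; have -> : v = take (size v) w by rewrite e take_size_cat.
by rewrite (br_take br); exact: prefix_take.
Qed.

Lemma fixed_prefix g v w : prefix v w -> a g w = w -> a g v = v.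
Proof.
move=> /prefixP[u e] gw; have -> : v = take (size v) w by rewrite e take_size_cat.
by rewrite (br_take br) gw.
Qed.

Lemma prefix_same_size (v w : seq bool) : size v = size w -> prefix v w -> v = w.
Proof.
move=> vw /prefixP[u e]; move: vw; rewrite e size_cat -[LHS]addn0.
by move=> /addnI/esym/size0nil ->; rewrite cats0.
Qed.

Lemma branch_commute v w x y : size v = size w -> v <> w -> K v x -> K w y ->
  commute x y.
Proof.
move=> vw nvw Kx Ky; rewrite /commute.
suff h u : a (x * y) u = a (y * x) u.
  apply: (mulIg (y * x)^-1); rewrite mulgV; apply: (br_faithful br) => u.
  by rewrite (br_actM br) h -(br_actM br) mulgV (br_act1 br).
have dis u' : prefix v u' -> ~~ prefix w u'.
  move=> vu'; apply/negP => wu'; apply: nvw.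
  move: vu' wu'; rewrite !prefixE vw => /eqP <- /eqP //.
have stab v' z : K v' z -> prefix v' u -> prefix v' (a z u).
  move=> Kz v'u; apply/negPn/negP => nv'.
  have := br_supp br (proj2 (br_sub br v') _ _ (proj1 (br_sub br v')) Kz) nv'.
  by rewrite mul1g br_actK => e; rewrite -e v'u in nv'.
rewrite !(br_actM br).
have [vu|nvu] := boolP (prefix v u).
  rewrite (br_supp br Ky (dis _ vu)) (br_supp br Ky)//.
  by apply: dis; exact: stab.
rewrite (br_supp br Kx nvu).
have [wu|nwu] := boolP (prefix w u).
  rewrite (br_supp br Kx)//; apply/negP => /dis.
  by rewrite (stab _ _ Ky wu).
by rewrite (br_supp br Ky nwu) (br_supp br Kx nvu).
Qed.

Lemma K_conj_to v g x : K v x -> a g v <> v ->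
  forall y, K v y -> commute (x ^ g) y.
Proof.
move=> Kx gv y; apply: (branch_commute (v := a g v)) => //.
  exact: br_size br _ _.
exact: br_conj br _ _ _ Kx.
Qed.

(** The double commutator trick: [s, g] = s^-1 s^g, and the factor s^g is invisible to t. *)
Lemma commRR (g s t : G) : commute (s ^ g) t ->
  [~ [~ s, g], t] = [~ s^-1, t] ^ (s ^ g).
Proof.
move=> c; rewrite [[~ s, g]]commgEl !commgEl conjMg (_ : (s ^ g) ^ t = s ^ g).
  by rewrite invgM !conjgE !mulgA.
by rewrite conjgE c mulKg.
Qed.

End BranchingTheory.

Section BranchingTheory2.
Variables (G : groupType) (a : G -> seq bool -> seq bool).
Variables (K : seq bool -> G -> Prop) (br : branching a K).

(* Each k_i moves a prefix of v u fixed by all the later k_j, so the k_i lie in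
   pairwise different cosets of the stabilizer of v u. *)
Lemma K_chain t v : exists M, forall u, size u = M -> exists k : nat -> G,
  (forall i, (i < t)%N -> K v (k i)) /\
  forall i j, (i < j < t)%N ->
    exists w, [/\ prefix w (v ++ u), a (k i) w <> w & K w (k j)].
Proof.
elim: t v => [|t IH] v.
  by exists 0%N => u _; exists (fun=> 1); split=> [//|i j]; rewrite ltn0 andbF.
have [m hm] := br_moves br v.
pose P u1 M := forall u2, size u2 = M -> exists k : nat -> G,
  (forall i, (i < t)%N -> K (v ++ u1) (k i)) /\
  forall i j, (i < j < t)%N ->
    exists w, [/\ prefix w (v ++ u1 ++ u2), a (k i) w <> w & K w (k j)].
have [M hM] : exists M, forall u1, size u1 = m -> P u1 M.
  apply: uniform_words => [u1 M M' MM' h u2 u2M'|u1 _]; last first.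
    have [M hM] := IH (v ++ u1); exists M => u2 /hM [k [Kk kk]].
    by exists k; split=> // i j /kk[w]; rewrite catA; exists w.
  have [|k [Kk kk]] := h (take M u2); first by rewrite size_takel// u2M'.
  exists k; split=> // i j /kk[w [wu kw Kw]]; exists w; split=> //.
  by rewrite -(cat_take_drop M u2) !catA prefix_catl// -catA.
exists (m + M)%N => u uM; pose u1 := take m u; pose u2 := drop m u.
have u1m : size u1 = m by rewrite size_takel// uM leq_addr.
have uE : u = u1 ++ u2 by rewrite cat_take_drop.
have [|k [Kk kk]] := hM u1 u1m u2; first by rewrite size_drop uM addKn.
have [g Kg gu] := hm u1 u1m.
exists (fun i => if i is i'.+1 then k i' else g); split=> [[|i] it //|].
  exact: (br_cat br (Kk i it)).
move=> [|i] [|j] //=; rewrite !ltnS.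
  move=> jt; exists (v ++ u1); split=> //; last exact: Kk.
  by rewrite uE catA prefix_prefix.
by move=> /kk[w]; rewrite uE; exists w.
Qed.

(** Pigeonhole on a chain longer than the number of labels: for i < j with equal labels, k_i moves
    some prefix w of v u off itself, and k_j, supported below w, cannot bring it back. *)
Lemma finite_index_moves v (Q : G -> Prop) : finite_index_in (K v) Q ->
  exists M, forall u, size u = M ->
    exists g, [/\ K v g, Q g & a g (v ++ u) <> v ++ u].
Proof.
move=> [T [f fP]]; have [M hM] := K_chain #|T|.+1 v; exists M => u /hM[k [Kk kk]].
have /injectivePn[i [j ij fij]] :
    ~~ injectiveb [ffun i : 'I_#|T|.+1 => f (k i)].
  apply/negP => /injectiveP /leq_card.
  by rewrite card_ord ltnn.
wlog : i j ij fij / (i < j)%N => [wl|lt_ij].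
  have [|ji|/val_inj e] := ltngtP i j; first exact: wl.
    by apply: (wl j i) => //; rewrite eq_sym.
  by rewrite e eqxx in ij.
rewrite !ffunE in fij.
have [w [wu kiw Kj]] : exists w, [/\ prefix w (v ++ u), a (k i) w <> w & K w (k j)].
  by apply: kk; rewrite lt_ij ltn_ord.
have Ki := Kk i (ltn_ord i); have Kj' := Kk j (ltn_ord j).
have [K1 KF] := br_sub br v.
exists (k i * (k j)^-1); split; [exact: KF|exact: fP|].
move=> /(fixed_prefix br wu); rewrite (br_actM br) (br_supp br (v := w))//.
  exact: subgroupV (br_sub br w) Kj.
apply/negP => /prefix_same_size; rewrite (br_size br) => /(_ erefl) e.
exact: kiw (esym e).
Qed.

(* K_w' is contained in the normal core N of Q: with g in N moving w, the
   double commutators [[g, s], t], s and t in K_w, lie in N. *)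
Lemma finite_index_derived v (Q : G -> Prop) : is_subgroup Q ->
  finite_index_in (K v) Q ->
  exists M, forall u, size u = M -> forall S : G -> Prop, is_subgroup S ->
    (forall x y, Q x -> K v x -> Q y -> K v y -> S [~ x, y]) ->
    forall g, K (v ++ u) g -> S g.
Proof.
move=> sQ /(finite_index_in_core (br_sub br v) sQ) [N [sN NQ NJ fN]].
have [M hM] := finite_index_moves fN.
pose P u M' := forall u', size u' = M' -> forall S : G -> Prop, is_subgroup S ->
  (forall x y, Q x -> K v x -> Q y -> K v y -> S [~ x, y]) ->
  forall g, K (v ++ u ++ u') g -> S g.
suff [M' hM'] : exists M', forall u, size u = M -> P u M'.
  exists (M + M')%N => u uM S sS SR g.
  rewrite -(cat_take_drop M u); apply: hM' => //.
    by rewrite size_takel// uM leq_addr.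
  by rewrite size_drop uM addKn.
apply: uniform_words => [u m m' mm' h u' u'm' S sS SR g|u uM].
  rewrite -(cat_take_drop m u') !catA => /(br_cat br); rewrite -catA.
  by apply: h => //; rewrite size_takel// u'm'.
have [g [Kg Ng gu]] := hM u uM; set w := v ++ u in gu.
have Kwv z : K w z -> K v z by exact: (@br_cat _ _ _ br v u z).
have [m hm] := br_derived br w.
have KN u' : size u' = m -> forall x, K (w ++ u') x -> N x.
  move=> /hm; apply => // s t Ks Kt.
  have Kws := Kwv _ Ks.
  have Ksi := subgroupV (br_sub br w) Ks.
  have cs := K_conj_to br Ksi gu Kt.
  have := commRR cs; rewrite invgK => e.
  have Nsg : N [~ s^-1, g].
    rewrite commgEr; apply: subgroupM => //; apply: NJ; first exact: subgroupV.
    exact: subgroupV (br_sub br v) Kws.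
  have Nsgt : N [~ [~ s^-1, g], t].
    rewrite commgEl; apply: subgroupM => //; first exact: subgroupV.
    by apply: NJ => //; exact: Kwv.
  have -> : [~ s, t] = [~ [~ s^-1, g], t] ^ (s^-1 ^ g)^-1.
    by rewrite e conjgK.
  have -> : [~ [~ s^-1, g], t] ^ (s^-1 ^ g)^-1 =
      ([~ [~ s^-1, g], t] ^ (s^-1 * [~ s^-1, g])^-1).
    by congr (_ ^ _^-1); rewrite commgEl mulgA mulgV mul1g.
  rewrite invgM conjgM; apply: NJ; last by rewrite invgK.
  apply: (subgroupJ sN) => //; exact: subgroupV.
(* Once K_(wu') lies in N, hence in Q, its commutators lie in S; a second use of branching converts
   them into K_(wu'u''). *)
have [m' hm'] : exists m', forall u', size u' = m ->
    forall u'', size u'' = m' -> forall S : G -> Prop, is_subgroup S ->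
    (forall x y, K (w ++ u') x -> K (w ++ u') y -> S [~ x, y]) ->
    forall g, K (w ++ u' ++ u'') g -> S g.
  apply: uniform_words => [u' k k' kk' h u'' u''k' S sS SR x|u' _].
    rewrite -(cat_take_drop k u'') !catA => /(br_cat br); rewrite -catA.
    by apply: h => //; rewrite size_takel// u''k'.
  have [k hk] := br_derived br (w ++ u'); exists k => u'' u''k S sS SR x.
  by rewrite catA; exact: (hk u'').
exists (m + m')%N => u' u'm S sS SR x.
rewrite catA -/w -(cat_take_drop m u').
have um : size (take m u') = m by rewrite size_takel// u'm leq_addr.
apply: hm' => //; first by rewrite size_drop u'm addKn.
have Kv y : K (w ++ take m u') y -> K v y.
  by move=> Ky; apply: Kwv; exact: (@br_cat _ _ _ br w _ y Ky).
move=> y z Ky Kz; apply: SR; try exact: Kv.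
  exact/NQ/(KN _ um).
exact/NQ/(KN _ um).
Qed.

(** The projection to K_v of the elements of H in the product of K_v and K_v', where v' is the image
    of v under h^-1. When h moves v, these two factors commute. *)
Definition linked (H : G -> Prop) (h : G) (v : seq bool) (x : G) : Prop :=
  K v x /\ exists2 y, K (a h^-1 v) y & H (x * y).

(** The normalizer in K_v of the intersection of H and K_v. *)
Definition normalizing (H : G -> Prop) (v : seq bool) (s : G) : Prop :=
  K v s /\ forall n, K v n -> (H n <-> H (n ^ s)).

(** The two consequences of recurrence, isolated so that what follows from them is pure algebra
    about a single subgroup H. *)
Definition rich (H : G -> Prop) : Prop :=
  (forall h v, H h -> a h v <> v -> finite_index_in (K v) (linked H h v)) /\
  (forall v x y, H (x * y) -> K v x -> (forall s, K v s -> commute s y) ->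
    finite_index_in (normalizing H v) (fun s => H [~ s, x])).

Lemma linked_subgroup H h v : is_subgroup H -> a h v <> v ->
  is_subgroup (linked H h v).
Proof.
move=> sH hv; pose v' := a h^-1 v.
have v'v : v <> v' by move=> e; apply: hv; rewrite {1}e (br_actVK br).
have svv' : size v = size v' by rewrite (br_size br).
split.
  split; first exact: (br_sub br v).1.
  exists 1; first exact: (br_sub br v').1.
  by rewrite mulg1; exact: sH.1.
move=> x1 x2 [K1 [y1 Ky1 H1]] [K2 [y2 Ky2 H2]]; split; first exact: (br_sub br v).2.
have Ky := (br_sub br v').2 _ _ Ky1 Ky2.
exists (y1 * y2^-1) => //.
have c := branch_commute br svv' v'v (subgroupV (br_sub br v) K2) Ky.
have -> : x1 * x2^-1 * (y1 * y2^-1) = x1 * y1 * (x2 * y2)^-1.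
  by rewrite -mulgA c invgM !mulgA.
exact: sH.2.
Qed.

Lemma normalizing_subgroup H v : is_subgroup (normalizing H v).
Proof.
have sK := br_sub br v.
split; first by split; [exact: sK.1|move=> n _; rewrite conjg1].
move=> s t [Ks nH] [Kt tH]; have KtV := subgroupV sK Kt.
split=> [|n Kn]; first exact: sK.2.
have Kst : K v (n ^ (s * t^-1)) by apply: subgroupJ => //; exact: sK.2.
rewrite (nH n Kn) (tH _ Kst) -conjgM -mulgA mulVg mulg1//.
Qed.

(** [s t^-1, x] is the conjugate by t^-1 of [s, x] [t, x]^-1, and t^-1 normalizes the intersection
    of H and K_v. *)
Lemma centralizing_subgroup H v x : is_subgroup H -> K v x ->
  is_subgroup (fun s => normalizing H v s /\ H [~ s, x]).
Proof.
move=> sH Kx; have sK := br_sub br v; have sN := normalizing_subgroup H v.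
split; first by split; [exact: sN.1|rewrite comm1g; exact: sH.1].
move=> s t [Ns Hs] [Nt Ht]; split; first exact: sN.2.
have [Kt tH] := Nt.
have -> : [~ s * t^-1, x] = ([~ s, x] * [~ t, x]^-1) ^ t^-1.
  by rewrite invgR !commgEl !conjgE !invgM !invgK !mulgA !mulgK.
apply/tH; last by rewrite conjgKV; exact: sH.2.
apply: subgroupJ => //; last exact: subgroupV.
by apply: sK.2; apply: subgroupR => //; exact: Ns.1.
Qed.

(* N = H :&: K_v is normalized by L = linked H h v. If x in L moves a vertex w
   below v, the s in L :&: K_w with [s, x] in N form a subgroup Q of finite index
   in K_w, and [[s, x], t] is conjugate to [s^-1, t] for s, t in Q; hence N
   contains [Q, Q]. *)
Lemma rich_contains H v : is_subgroup H -> rich H -> (exists2 h, H h & a h v <> v) ->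
  exists M, forall u, size u = M -> forall g, K (v ++ u) g -> H g.
Proof.
move=> sH [r1 r2] [h Hh hv]; have fL := r1 h v Hh hv; set L := linked H h v in fL.
pose v' := a h^-1 v.
have v'v : v <> v' by move=> e; apply: hv; rewrite {1}e (br_actVK br).
have svv' : size v = size v' by rewrite (br_size br).
have comm s y : K v s -> K v' y -> commute s y.
  by move=> Ks Ky; exact: (branch_commute br svv' v'v Ks Ky).
have sL : is_subgroup L by exact: linked_subgroup.
(* As y centralizes K_v, conjugation by x on K_v is conjugation by x y, an element of H. *)
have LN x : L x -> normalizing H v x.
  move=> [Kx [y Ky Hxy]]; split=> // n Kn.
  have e : n ^ x = n ^ (x * y).
    rewrite conjgM; apply/esym/conjg_fixP/commgP.
    by apply: comm => //; exact: subgroupJ (br_sub br v) _ _.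
  rewrite e; split=> [Hn|Hn]; first exact: subgroupJ.
  by rewrite -[n](conjgK (x * y)); apply: subgroupJ => //; exact: subgroupV.
have [M hM] := finite_index_moves fL.
pose P u M' := forall u', size u' = M' -> forall g, K (v ++ u ++ u') g -> H g.
suff [M' hM'] : exists M', forall u, size u = M -> P u M'.
  exists (M + M')%N => u uM g.
  rewrite -(cat_take_drop M u); apply: hM' => //.
    by rewrite size_takel// uM leq_addr.
  by rewrite size_drop uM addKn.
apply: uniform_words => [u m m' mm' hP u' u'm' g|u uM].
  rewrite -(cat_take_drop m u') !catA => /(br_cat br); rewrite -catA.
  by apply: hP => //; rewrite size_takel// u'm'.
have [x [Kx [_ [y Ky Hxy]] xu]] := hM u uM; set w := v ++ u in xu.
have fC := r2 v x y Hxy Kx (fun s Ks => comm s y Ks Ky).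
have Kwv z : K w z -> K v z by exact: (@br_cat _ _ _ br v u z).
pose A z := K w z /\ L z; pose Q z := A z /\ H [~ z, x].
have sA : is_subgroup A.
  split; first by split; [exact: (br_sub br w).1|exact: sL.1].
  by move=> s t [Ks Ls] [Kt Lt]; split; [exact: (br_sub br w).2|exact: sL.2].
have sQ : is_subgroup Q.
  have sC := centralizing_subgroup sH Kx.
  split; first by split; [exact: sA.1|exact: sC.1.2].
  move=> s t [As Hs] [At Ht]; split; first exact: sA.2.
  exact: (sC.2 s t (conj (LN _ As.2) Hs) (conj (LN _ At.2) Ht)).2.
have fQ : finite_index_in (K w) Q.
  apply: (@finite_index_in_trans _ _ A) => // [z []//||].
    by apply: finite_index_inI (br_sub br w) Kwv fL.
  apply: (@finite_index_inI _ (normalizing H v) (fun s => H [~ s, x])) => //.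
  by move=> z [_]; exact: LN.
have [m hm] := finite_index_derived sQ fQ; exists m => u' /hm KQ g.
rewrite catA -/w; apply: (KQ H sH) => s t Qs Ks Qt Kt.
have Qsi := subgroupV sQ Qs.
have Ksi := subgroupV (br_sub br w) Ks.
have := commRR (K_conj_to br Ksi xu Kt); rewrite invgK => e.
rewrite -[[~ s, t]](conjgK (s^-1 ^ x)) -e.
have -> : s^-1 ^ x = s^-1 * [~ s^-1, x] by rewrite commgEl mulgA mulgV mul1g.
have KR z : K w z -> K v [~ z, x].
  by move=> Kz; apply: subgroupR (br_sub br v) _ _ => //; exact: Kwv.
have HR : H [~ [~ s^-1, x], t].
  rewrite commgEl; apply: subgroupM => //; first exact: subgroupV Qsi.2.
  by apply/(proj1 ((LN _ Qt.1.2).2 _ (KR _ Ksi))); exact: Qsi.2.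
rewrite invgM conjgM (invgK s); apply/(proj1 ((LN _ Qs.1.2).2 _ _)).
  apply: subgroupJ (br_sub br v) _ _; last exact: subgroupV (br_sub br v) (KR _ Ksi).
  by apply: subgroupR (br_sub br v) (KR _ Ksi) _; exact: Kwv.
by apply: subgroupJ => //; apply: subgroupV => //; exact: Qsi.2.
Qed.

End BranchingTheory2.

(** * Fixed boundary points and approximations *)

Lemma all_true_or_false (u : seq bool) :
  u = nseq (size u) true \/ exists j u', u = nseq j true ++ false :: u'.
Proof.
elim: u => [|[] u [uE|[j [u' uE]]]]; first by left.
- by left; rewrite {1}uE.
- by right; exists j.+1, u'; rewrite uE.
- by right; exists 0%N, u.
- by right; exists 0%N, u.
Qed.

Section Approximation.
Variables (G : groupType) (a : G -> seq bool -> seq bool).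
Variables (K : seq bool -> G -> Prop) (br : branching a K).
Implicit Types H : SubSpace G.

Definition mem_Sub H (g : G) : Prop := g \in pred_of_Sub H.

Lemma mem_Sub_subgroup H : is_subgroup (mem_Sub H).
Proof. exact: pred_of_SubP. Qed.

Lemma eq_Sub H H' : (forall g, mem_Sub H g <-> mem_Sub H' g) -> H = H'.
Proof.
move=> HH'; apply: val_inj; apply/funext => g; apply/idP/idP => Hg.
  by have /HH' := (Hg : mem_Sub H g).
by have /HH' := (Hg : mem_Sub H' g).
Qed.

Lemma mem_conj_Sub g H x : mem_Sub (conj_Sub g H) x <-> mem_Sub H (x ^ g^-1).
Proof. by []. Qed.

Lemma mem_mkSub (S : {pred G}) (cS : group_closed S) g :
  mem_Sub (mkSub cS) g <-> g \in S.
Proof. by []. Qed.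

Lemma conj_SubM g h H : conj_Sub h (conj_Sub g H) = conj_Sub (g * h) H.
Proof. by apply: eq_Sub => x; rewrite !mem_conj_Sub invgM conjgM. Qed.

Lemma conj_Sub1 H : conj_Sub 1 H = H.
Proof. by apply: eq_Sub => x; rewrite mem_conj_Sub invg1 conjg1. Qed.

Lemma conj_Sub_id h H : mem_Sub H h -> conj_Sub h H = H.
Proof.
move=> Hh; have sH := mem_Sub_subgroup H; apply: eq_Sub => x; rewrite mem_conj_Sub.
have HhV := subgroupV sH Hh.
split=> [Hx|Hx]; last exact: subgroupJ.
by rewrite -[x](conjgKV h); exact: subgroupJ.
Qed.

(* A boundary point is fixed by H iff all its prefixes are alive. *)
Definition alive H v : Prop := forall m, exists2 u, size u = m &
  forall h, mem_Sub H h -> a h (v ++ u) = v ++ u.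

Lemma alive_fix H v h : alive H v -> mem_Sub H h -> a h v = v.
Proof. by move=> /(_ 0%N)[u /size0nil ->] Hf /Hf; rewrite cats0. Qed.

Lemma alive_cat H v u : alive H (v ++ u) -> alive H v.
Proof.
move=> al m; have [u' u'm Hf] := al m; exists (take m (u ++ u')).
  by rewrite size_takel// size_cat u'm leq_addl.
move=> h /Hf; apply: (fixed_prefix br).
by rewrite -catA -{2}(cat_take_drop m (u ++ u')) catA prefix_prefix.
Qed.

(** Compactness of the boundary, as in König's lemma: if both children died, at depths m0 and m1,
    then no word at depth max(m0, m1) + 1 below v would be fixed by H. *)
Lemma alive_child H v : alive H v -> exists b, alive H (v ++ [:: b]).
Proof.
move=> al; apply: contrapT => /forallNP nal.
have bad b : exists m, forall u, size u = m ->
    exists2 h, mem_Sub H h & a h (v ++ [:: b] ++ u) <> v ++ [:: b] ++ u.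
  have /existsNP[m hm] := nal b; exists m => u um.
  apply: contrapT => nh; apply: hm; exists u => // h Hh; apply: contrapT => hu.
  by apply: nh; exists h => //; rewrite catA.
have [[m0 h0] [m1 h1]] := (bad false, bad true).
have [[|b u] //= [um] Hf] := al (maxn m0 m1).+1.
have : exists m, (m <= size u)%N /\ forall u, size u = m ->
    exists2 h, mem_Sub H h & a h (v ++ [:: b] ++ u) <> v ++ [:: b] ++ u.
  by case: b {Hf}; [exists m1|exists m0]; rewrite um ?leq_maxr ?leq_maxl.
move=> [m [mu /(_ (take m u))]]; rewrite size_takel// => /(_ erefl)[h Hh]; apply.
apply: (fixed_prefix br) (Hf h Hh).
by rewrite -[b :: u]cat1s -{2}(cat_take_drop m u) !catA prefix_prefix.
Qed.

Lemma alive_extend H v m : alive H v -> exists2 u, size u = m & alive H (v ++ u).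
Proof.
elim: m v => [|m IH] v al; first by exists [::]; rewrite ?cats0.
have [b /IH[u um alu]] := alive_child al; exists (b :: u); first by rewrite /= um.
by rewrite -cat1s catA.
Qed.

Lemma alive_conj g H v : alive (conj_Sub g H) (a g v) <-> alive H v.
Proof.
suff al k H' u : alive H' u -> alive (conj_Sub k H') (a k u).
  split; last exact: al.
  by move/(al g^-1); rewrite conj_SubM mulgV conj_Sub1 (br_actK br).
move=> alu m; have [w wm Hf] := alu m.
exists (drop (size u) (a k (u ++ w))).
  by rewrite size_drop (br_size br) size_cat wm addKn.
have e : a k u ++ drop (size u) (a k (u ++ w)) = a k (u ++ w).
  rewrite -[RHS](cat_take_drop (size u)); congr (_ ++ _).
  by rewrite -(br_take br) take_size_cat.
rewrite e => h /mem_conj_Sub /Hf; rewrite conjgE invgK !(br_actM br) => e'.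
by rewrite -{2}e' (br_actVK br).
Qed.

Lemma alive_act h H v : mem_Sub H h -> alive H (a h v) <-> alive H v.
Proof. by move=> Hh; have := alive_conj h H v; rewrite conj_Sub_id. Qed.

(* H is replaced by the product of its elements trivial below the alive vertices
   of level n and of all the elements supported below these vertices that fix
   them. *)
Definition Phi_spec n H (g : G) : Prop :=
  (forall v, size v = n -> alive H v -> a g v = v) /\
  exists h, [/\ mem_Sub H h,
    forall v, size v = n -> alive H v -> forall w, a h (v ++ w) = v ++ w &
    forall v, size v = n -> ~ alive H v -> forall w, a g (v ++ w) = a h (v ++ w)].

Definition Phi_pred n H : {pred G} := fun g => `[< Phi_spec n H g >].

Lemma Phi_closed n H : group_closed (Phi_pred n H).
Proof.
have [H1 HF] := mem_Sub_subgroup H.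
split.
  apply/asboolP; split=> [v _ _|]; first exact: br_act1 br _.
  by exists 1; split=> // v _ _ w; exact: br_act1 br _.
move=> x y /asboolP[xf [h [Hh hal hn]]] /asboolP[yf [k [Hk kal kn]]].
have fixV z w : a z w = w -> a z^-1 w = w.
  by move=> e; rewrite -{1}e (br_actK br).
apply/asboolP; split.
  by move=> v vn al; rewrite (br_actM br) (xf v)// fixV// yf.
exists (h * k^-1); split; first exact: HF.
  by move=> v vn al w; rewrite (br_actM br) (hal v)// fixV// kal.
move=> v vn nal w; rewrite !(br_actM br) (hn v)//.
have [w' ->] : exists w', a h (v ++ w) = a h v ++ w'.
  by have /(br_prefix br h)/prefixP := prefix_prefix v w.
have hvn : size (a h v) = n by rewrite (br_size br).
(* Elements of H permute the dead vertices of level n, so that y and k still agree where h has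
   carried the word. *)
have nalh : ~ alive H (a h v) by rewrite alive_act.
have KV : mem_Sub H k^-1 by exact: subgroupV (mem_Sub_subgroup H) Hk.
set u := a k^-1 (a h v ++ w').
have ue : u = a k^-1 (a h v) ++ drop n u.
  rewrite -[LHS](cat_take_drop n); congr (_ ++ _).
  by rewrite /u -(br_take br) take_size_cat.
rewrite -[LHS](br_actK br y) (br_actVK br) -[a h v ++ w']/(a h v ++ w').
have -> : a h v ++ w' = a y u.
  rewrite ue kn ?(br_size br)//; last by rewrite alive_act.
  by rewrite -ue (br_actVK br).
by rewrite (br_actK br).
Qed.

Definition Phi n H : SubSpace G := mkSub (Phi_closed n H).

Lemma mem_Phi n H g : mem_Sub (Phi n H) g <-> Phi_spec n H g.
Proof. by rewrite /Phi mem_mkSub; split=> /asboolP. Qed.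

Lemma Phi_conj n g H : Phi n (conj_Sub g H) = conj_Sub g (Phi n H).
Proof.
suff sub k H' x : Phi_spec n H' x -> Phi_spec n (conj_Sub k H') (x ^ k).
  apply: eq_Sub => x; rewrite mem_conj_Sub !mem_Phi; split.
    by move/(sub g^-1); rewrite conj_SubM mulgV conj_Sub1.
  by move/(sub g); rewrite conjgKV.
move=> [xf [h [Hh hal hn]]].
have alV v : alive (conj_Sub k H') v <-> alive H' (a k^-1 v).
  by have := alive_conj k H' (a k^-1 v); rewrite (br_actVK br).
have cat v w : exists w', a k^-1 (v ++ w) = a k^-1 v ++ w'.
  by have /(br_prefix br k^-1)/prefixP := prefix_prefix v w.
split=> [v vn /alV al|].
  by rewrite conjgE !(br_actM br) xf ?(br_size br)// (br_actVK br).
exists (h ^ k); split; first by apply/mem_conj_Sub; rewrite conjgK.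
  move=> v vn /alV al w; rewrite conjgE !(br_actM br); have [w' e] := cat v w.
  by rewrite e hal ?(br_size br)// -e (br_actVK br).
move=> v vn nal w; rewrite !conjgE !(br_actM br); have [w' ->] := cat v w.
by rewrite (hn (a k^-1 v)) ?(br_size br)// => /alV.
Qed.

Lemma K_fix v g : K v g -> a g v = v.
Proof.
move=> Kg; apply: contrapT => gv; have := br_supp br (w := a g v) Kg.
have nv : ~~ prefix v (a g v).
  apply/negP => /prefix_same_size; rewrite (br_size br) => /(_ erefl) e.
  exact: gv (esym e).
by move=> /(_ nv) /(can_inj (br_actK br g)).
Qed.

Lemma supp_other v v' g w : K v g -> size v' = size v -> v' <> v ->
  a g (v' ++ w) = v' ++ w.
Proof.
move=> Kg vv' nv; apply: (br_supp br) => //; first exact: Kg.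
apply/negP => /prefixP[u /eqP]; rewrite eqseq_cat// => /andP[/eqP].
by move=> /nv.
Qed.

Lemma alive_K_Phi n H v g : size v = n -> alive H v -> K v g -> Phi_spec n H g.
Proof.
move=> vn al Kg; split=> [v' v'n al'|].
  have [->|/eqP v'v] := eqVneq v' v; first exact: K_fix.
  by rewrite -[v']cats0; apply: supp_other Kg _ v'v; rewrite v'n.
exists 1; split; first exact: (mem_Sub_subgroup H).1.
  by move=> *; exact: br_act1 br _.
move=> v' v'n nal w; rewrite (br_act1 br); apply: supp_other Kg _ _.
  by rewrite v'n.
by move=> e; apply: nal; rewrite e.
Qed.

Lemma dead_K_Phi n H v g : size v = n -> ~ alive H v -> mem_Sub H g -> K v g ->
  Phi_spec n H g.
Proof.
move=> vn nal Hg Kg; split=> [v' _ /alive_fix|]; first exact.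
exists g; split=> // v' v'n al w; apply: supp_other Kg _ _; first by rewrite v'n.
by move=> e; apply: nal; rewrite -e.
Qed.

Lemma finite_index_Phi n H : rich a K (mem_Sub H) ->
  finite_index_in (fun=> True) (mem_Sub (Phi n H)).
Proof.
move=> rH; have sH := mem_Sub_subgroup H.
pose P v M := forall u, size u = M -> forall g, K (v ++ u) g -> Phi_spec n H g.
have [M hM] : exists M, forall v, size v = n -> P v M.
  apply: uniform_words => [v m m' mm' h u um' g|v vn].
    rewrite -(cat_take_drop m u) catA => /(br_cat br); apply: h.
    by rewrite size_takel// um'.
  have [al|nal] := pselect (alive H v).
    by exists 0%N => u _ g /(br_cat br); exact: alive_K_Phi.
  (* Death of v gives a depth m at which every descendant is moved by some element of H, so that
     [rich_contains] applies to each of them. *)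
  have /existsNP[m hm] := nal.
  pose Q u M := forall u', size u' = M -> forall g, K (v ++ u ++ u') g -> mem_Sub H g.
  have [M hM] : exists M, forall u, size u = m -> Q u M.
    apply: uniform_words => [u k k' kk' h u' u'k' g|u um].
      rewrite -(cat_take_drop k u') !catA => /(br_cat br); rewrite -catA.
      by apply: h; rewrite size_takel// u'k'.
    have [|k hk] := @rich_contains _ _ _ br _ (v ++ u) sH rH.
      apply: contrapT => nh; apply: hm; exists u => // h Hh; apply: contrapT => hu.
      by apply: nh; exists h.
    by exists k => u' /hk; rewrite -catA.
  exists (m + M)%N => u um g Kg; apply: (dead_K_Phi vn nal _ (br_cat br Kg)).
  move: Kg; rewrite -(cat_take_drop m u); apply: hM.
    by rewrite size_takel// um leq_addr.
  by rewrite size_drop um addKn.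
apply: (br_finite br (n := n + M)); first exact: mem_Sub_subgroup.
move=> v vnM g Kg; apply/mem_Phi.
apply: (hM (take n v)) (drop n v) _ _ _.
- by rewrite size_takel// vnM leq_addr.
- by rewrite size_drop vnM addKn.
- by rewrite cat_take_drop.
Qed.

(** The negation of the bad event: v1^oo is a fixed boundary point while v1^k0 is dead for all k in
    S. *)
Definition escapes H v (S : pred nat) : Prop := exists k,
  ~ alive H (v ++ nseq k true) \/ S k /\ alive H (v ++ nseq k true ++ [:: false]).

(** A vertex whose children are moved by g cannot be alive, since it would have an alive child,
    fixed by g. This excludes the germ a, and for a spinal germ it makes v1^k0 dead for k in S. So
    the ray must die; alive vertices beyond that depth branch off at some j outside S, where g is
    trivial. *)
Lemma fixing_trivial_near H g n (S : seq bool -> pred nat) :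
  (forall v, size v = n -> a g v = v -> germ_at a g v (S v)) ->
  (forall v, (forall m, exists2 k, (m <= k)%N & S v k) -> escapes H v (S v)) ->
  (forall v, alive H v -> a g v = v) ->
  exists n0, forall v, size v = n0 -> alive H v -> forall w, a g (v ++ w) = v ++ w.
Proof.
move=> gS esc gal.
pose P v M := forall u, size u = M -> alive H (v ++ u) ->
  forall w, a g (v ++ u ++ w) = v ++ u ++ w.
suff [M hM] : exists M, forall v, size v = n -> P v M.
  exists (n + M)%N => v vnM; rewrite -(cat_take_drop n v) => al w.
  rewrite -catA; apply: hM => //; first by rewrite size_takel// vnM leq_addr.
  by rewrite size_drop vnM addKn.
apply: uniform_words => [v m m' mm' h u um' al w|v vn].
  have e : v ++ u ++ w = v ++ take m u ++ drop m u ++ w.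
    by rewrite [take m u ++ _]catA cat_take_drop.
  rewrite e; apply: h; first by rewrite size_takel// um'.
  by move: al; rewrite -{1}(cat_take_drop m u) catA => /alive_cat.
have [al|nal] := pselect (alive H v); last first.
  by exists 0%N => u _ /alive_cat.
case: (gS v vn (gal v al)) => [triv|move_|[Sinf Sg]].
- by exists 0%N => u _ _ w; exact: triv.
- have [b alb] := alive_child al; exfalso; apply: (move_ b); exact: gal.
have [k [nalk|[Sk alk]]] := esc v Sinf; last first.
  have [b alb] := alive_child alk; exfalso; have := Sg k; rewrite /= Sk => /(_ b).
  by apply; apply: gal; rewrite -!catA in alb *.
exists k => u uk alu w.
have [uE|[j [u' uE]]] := all_true_or_false u.
  by case: nalk; rewrite -uk -uE.
have /= := Sg j; case: (S v j) => Sgj; last first.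
  have e : v ++ u ++ w = (v ++ nseq j true) ++ false :: (u' ++ w).
    by rewrite uE -(cat1s false (u' ++ w)) -(cat1s false u') !catA.
  by rewrite e Sgj.
have /alive_child[b] : alive H (v ++ nseq j true ++ [:: false]).
  by move: alu; rewrite uE -cat1s !catA => /alive_cat.
move=> /gal; rewrite -!catA /= => e; exfalso; apply: (Sgj b).
by rewrite -!catA.
Qed.

Definition germ_rigid H : Prop := forall g, (forall v, alive H v -> a g v = v) ->
  exists n0, forall v, size v = n0 -> alive H v -> forall w, a g (v ++ w) = v ++ w.

(** If g moves an alive vertex, it is neither in H nor in Phi_n H for large n. Otherwise, for large
    n, g is trivial below the alive vertices, as is the h witnessing its membership in Phi_n H;
    hence g = h. *)
Lemma Phi_cvg_mem H g : germ_rigid H -> exists n0, forall n, (n0 <= n)%N ->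
  (mem_Sub (Phi n H) g <-> mem_Sub H g).
Proof.
move=> rig; have [gal|] := pselect (forall v, alive H v -> a g v = v); last first.
  move=> /existsNP[v /not_implyP[al gv]]; exists (size v) => n vn.
  split=> [/mem_Phi[gf _]|Hg]; last by case: gv; exact: alive_fix.
  have [u un alu] := alive_extend (n - size v) al; case: gv.
  apply: (fixed_prefix br (prefix_prefix v u)); apply: gf => //.
  by rewrite size_cat un subnKC.
have [n0 gn0] := rig g gal; exists n0 => n n0n.
have gn v : size v = n -> alive H v -> forall w, a g (v ++ w) = v ++ w.
  move=> vn al w; rewrite -(cat_take_drop n0 v) -catA; apply: gn0.
    by rewrite size_takel// vn.
  by move: al; rewrite -{1}(cat_take_drop n0 v) => /alive_cat.
split=> [/mem_Phi[_ [h [Hh hal hn]]]|Hg]; last first.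
  by apply/mem_Phi; split=> [v _|]; [exact: gal|exists g; split].
suff -> : g = h by [].
apply: (mulIg h^-1); rewrite mulgV; apply: (br_faithful br) => w.
rewrite (br_actM br); suff -> : a g w = a h w by exact: br_actK br _ _.
have long u : (n <= size u)%N -> a g u = a h u.
  move=> nu; rewrite -(cat_take_drop n u).
  have tn : size (take n u) = n by rewrite size_takel.
  have [al|nal] := pselect (alive H (take n u)); last exact: hn.
  by rewrite gn// hal.
have := long (w ++ nseq n true); rewrite size_cat size_nseq leq_addl => /(_ isT).
move=> /(congr1 (take (size w))); rewrite -!(br_take br) take_size_cat//.
Qed.

End Approximation.

(** * Topology and measurability on the space of subgroups *)

Section SubTopology.
Variable G : groupType.
Implicit Types H : SubSpace G.

Lemma cvg_Sub (F : set_system (SubSpace G)) (FF : Filter F) H :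
  (forall g, F [set H' | (g \in pred_of_Sub H') = (g \in pred_of_Sub H)]) ->
  F --> H.
Proof.
move=> FH A; rewrite nbhsE => -[U [[W oW <-] /= WH] UA].
apply: (filterS UA).
have cF : (val @ F) --> (val H : {ptws G -> bool}).
  apply/cvg_sup => g B; rewrite nbhsE => -[C [[V oV <-] /= VH] CB].
  apply: (filterS CB); rewrite /= /nbhs /=.
  apply: filterS (FH g) => H' e; rewrite /preimage /=.
  have e' : val H' g = val H g := e.
  by rewrite e'.
by apply: cF; exact: open_nbhs_nbhs.
Qed.

Lemma open_mem_Sub g : open [set H : SubSpace G | mem_Sub H g].
Proof.
exists ((fun f : {ptws G -> bool} => f g) @^-1` [set true]) => //.
apply: open_comp; last exact: discrete_open.
by move=> f _; exact: proj_continuous.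
Qed.

Lemma cvg_Sub_seq (u : nat -> SubSpace G) H :
  (forall g, exists n0, forall n, (n0 <= n)%N -> (mem_Sub (u n) g <-> mem_Sub H g)) ->
  u @ \oo --> H.
Proof.
move=> uH; apply: cvg_Sub => g; have [n0 hn0] := uH g.
exists n0 => // n /= /hn0[h1 h2]; rewrite /preimage /=.
by apply/idP/idP; [exact: h1|exact: h2].
Qed.

(** The limit of an ultrafilter is the set of g that belong to almost all subgroups along it, which
    is again a subgroup. *)
Lemma compact_Sub : compact [set: SubSpace G].
Proof.
rewrite compact_ultra => F FU _.
pose S : {pred G} := fun g => `[< F [set H' : SubSpace G | mem_Sub H' g] >].
have SE g : g \in S <-> F [set H' : SubSpace G | mem_Sub H' g].
  by split=> [/asboolP|Fg] //; apply/asboolP.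
have cS : group_closed S.
  split.
    apply/SE; apply: filterS filterT => H' _.
    exact: (mem_Sub_subgroup H').1.
  move=> x y /SE Fx /SE Fy; apply/SE; apply: filterS2 Fx Fy => H' Hx Hy.
  exact: (mem_Sub_subgroup H').2.
exists (mkSub cS); split=> //; apply: cvg_Sub => g.
have e H' : (g \in pred_of_Sub H' <-> g \in S) ->
    (g \in pred_of_Sub H') = (g \in pred_of_Sub (mkSub cS)).
  by move=> [h1 h2]; apply/idP/idP; [exact: h1|exact: h2].
have [Fg|Fng] := in_ultra_setVsetC [set H' : SubSpace G | mem_Sub H' g] FU.
  by apply: filterS (Fg) => H0 Hg; apply: e; split=> // _; apply/SE.
apply: filterS (Fng) => H' nHg; apply: e; split=> [/nHg//|/SE Fg].
have [H'' [h1 h2]] := filter_ex (filterI Fg Fng).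
by case: (h2 h1).
Qed.

End SubTopology.

(** * Measurability of events by following their logical form *)

Section MeasurablePredicates.
Context d (T : measurableType d).
Implicit Types P Q : T -> Prop.

Lemma measurable_pcst (c : Prop) : measurable [set x : T | c].
Proof.
have [hc|nc] := pselect c.
  by rewrite (_ : [set _ | _] = setT)//; apply/seteqP; split.
by rewrite (_ : [set _ | _] = set0)//; apply/seteqP; split.
Qed.

Lemma measurable_pnot P : measurable [set x | P x] -> measurable [set x | ~ P x].
Proof. by move=> mP; exact: measurableC. Qed.

Lemma measurable_pand P Q : measurable [set x | P x] -> measurable [set x | Q x] ->
  measurable [set x | P x /\ Q x].
Proof. by move=> mP mQ; exact: measurableI. Qed.

Lemma measurable_por P Q : measurable [set x | P x] -> measurable [set x | Q x] ->
  measurable [set x | P x \/ Q x].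
Proof. by move=> mP mQ; exact: measurableU. Qed.

Lemma measurable_pimpl P Q : measurable [set x | P x] -> measurable [set x | Q x] ->
  measurable [set x | P x -> Q x].
Proof.
move=> mP mQ; have := measurable_por (measurable_pnot mP) mQ.
congr measurable; apply/seteqP; split=> x /=; first by case.
by move=> PQ; have [Px|nP] := pselect (P x); [right; exact: PQ|left].
Qed.

Lemma measurable_piff P Q : measurable [set x | P x] -> measurable [set x | Q x] ->
  measurable [set x | P x <-> Q x].
Proof. by move=> mP mQ; apply: measurable_pand; exact: measurable_pimpl. Qed.

Lemma measurable_pexists (I : countType) (P : I -> T -> Prop) :
  (forall i, measurable [set x | P i x]) -> measurable [set x | exists i, P i x].
Proof.
move=> mP; have := @countable_bigcupT_measurable _ T I (fun i => [set x | P i x]).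
move=> /(_ (countableP _) mP); congr measurable.
by apply/seteqP; split=> x /= [i]; [exists i|exists i].
Qed.

Lemma measurable_pforall (I : countType) (P : I -> T -> Prop) :
  (forall i, measurable [set x | P i x]) -> measurable [set x | forall i, P i x].
Proof.
move=> mP.
have := measurable_pnot (measurable_pexists (fun i => measurable_pnot (mP i))).
congr measurable; apply/seteqP; split=> x /=.
  by move=> nP i; apply: contrapT => nPi; apply: nP; exists i.
by move=> Px [i]; apply.
Qed.

End MeasurablePredicates.

Section Enumerated.
Context d (T : measurableType d) (G : Type) (e : nat -> G).
Hypothesis e_onto : forall g, exists n, e n = g.

Lemma measurable_pexists_enum (P : G -> T -> Prop) :
  (forall g, measurable [set x | P g x]) -> measurable [set x | exists g, P g x].
Proof.
move=> mP; have := measurable_pexists (fun n => mP (e n)).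
congr measurable; apply/seteqP; split=> x /=; first by move=> [n]; exists (e n).
by move=> [g]; have [n <-] := e_onto g; exists n.
Qed.

Lemma measurable_pforall_enum (P : G -> T -> Prop) :
  (forall g, measurable [set x | P g x]) -> measurable [set x | forall g, P g x].
Proof.
move=> mP; have := measurable_pforall (fun n => mP (e n)).
congr measurable; apply/seteqP; split=> x /=; last by move=> h n; exact: h.
by move=> h g; have [n <-] := e_onto g.
Qed.

End Enumerated.

Lemma measurable_mem_Sub (G : groupType) (g : G) :
  measurable [set H : SubSpace G | mem_Sub H g].
Proof. by apply: sub_sigma_algebra; exact: open_mem_Sub. Qed.

Section MeasurableSub.
Variables (G : groupType) (e : nat -> G).
Hypothesis e_onto : forall g, exists n, e n = g.
Implicit Types H : SubSpace G.

Definition cylinder (s : seq bool) : set (SubSpace G) :=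
  [set H | forall i : nat, (i < size s)%N -> (mem_Sub H (e i) <-> nth false s i)].

Lemma open_cylinders (U : set (SubSpace G)) : open U -> forall H, U H ->
  exists s, cylinder s H /\ cylinder s `<=` U.
Proof.
move=> oU H UH; apply: contrapT => nU.
pose s n := mkseq (fun i => e i \in pred_of_Sub H) n.
have sP n H' : cylinder (s n) H' <->
    forall i, (i < n)%N -> (mem_Sub H' (e i) <-> mem_Sub H (e i)).
  rewrite /cylinder /= size_mkseq; split=> h i it; have := h i it.
    by rewrite nth_mkseq.
  by rewrite nth_mkseq.
have /choice[u uP] : forall n, exists H', cylinder (s n) H' /\ ~ U H'.
  move=> n; apply: contrapT => nH'; apply: nU; exists (s n); split.
    by apply/sP.
  by move=> H' cH'; apply: contrapT => nUH'; apply: nH'; exists H'.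
have : u @ \oo --> H.
  apply: cvg_Sub_seq => g; have [m <-] := e_onto g; exists m.+1 => n mn.
  by have [/sP + _] := uP n; apply.
move=> /(_ U (open_nbhs_nbhs (conj oU UH)))[N _ /(_ N (leqnn N))].
exact: (uP N).2.
Qed.

(** An open set is the union of the countably many cylinders it contains, so the membership events
    of single elements suffice. *)
Lemma measurable_fun_Sub d (T : measurableType d) (f : T -> SubSpace G) :
  (forall g, measurable [set x | mem_Sub (f x) g]) -> measurable_fun setT f.
Proof.
move=> mf; apply: (@measurability _ _ _ _ setT f (@open (SubSpace G))) => //.
move=> _ [U oU <-]; rewrite setTI.
have : measurable [set x | exists s : seq bool, cylinder s (f x) /\ cylinder s `<=` U].
  apply: measurable_pexists => s; apply: measurable_pand; last exact: measurable_pcst.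
  apply: measurable_pforall => i; apply: measurable_pimpl; first exact: measurable_pcst.
  by apply: measurable_piff; [exact: mf|exact: measurable_pcst].
congr measurable; apply/seteqP; split=> x /=; first by move=> [s [cs]]; apply.
exact: open_cylinders.
Qed.

Lemma continuous_measurable_Sub (R : realType) (f : SubSpace G -> R) :
  continuous f -> measurable_fun setT f.
Proof.
move=> cf; apply: (measurability _ (measurable_realfun.RGenOpens.measurableE R)) => //.
move=> _ [_ [x [y ->]] <-]; rewrite setTI.
apply: sub_sigma_algebra; apply: open_comp; last exact: interval_open.
by move=> z _; exact: cf.
Qed.

Lemma continuous_bounded_Sub (R : realType) (f : SubSpace G -> R) :
  continuous f -> exists M : R, forall H, (`|f H| <= M)%R.
Proof.
move=> cf; have : compact (f @` setT).
  by apply: continuous_compact; [exact: continuous_subspaceT|exact: compact_Sub].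
move=> /compact_bounded [M [_ hM]]; exists (M + 1)%R => H.
by apply: (hM (M + 1)%R); [rewrite ltrDl|exists H].
Qed.

End MeasurableSub.

(** * Recurrence *)

Section IRS.
Variables (R : realType) (G : groupType) (e : nat -> G).
Hypothesis e_onto : forall g, exists n, e n = g.
Variable mu : probability (SubSpace G) R.
Hypothesis mu_irs : is_IRS mu.
Implicit Types H : SubSpace G.

Lemma ae_forall_count (I : countType) (P : I -> SubSpace G -> Prop) :
  (forall i, {ae mu, forall H, P i H}) -> {ae mu, forall H, forall i, P i H}.
Proof.
move=> aeP.
have : {ae mu, forall H, forall n, forall i : I, unpickle n = Some i -> P i H}.
  apply: ae_foralln => n; case En : (unpickle n) => [i|]; last by apply: aeW.
  by apply: filterS (aeP i) => H PH _ [<-].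
by apply: filterS => H PH i; apply: (PH (pickle i)); exact: pickleK.
Qed.

Lemma ae_forall_enum (P : G -> SubSpace G -> Prop) :
  (forall g, {ae mu, forall H, P g H}) -> {ae mu, forall H, forall g, P g H}.
Proof.
move=> aeP; have := ae_foralln (fun n => aeP (e n)).
by apply: filterS => H PH g; have [n <-] := e_onto g.
Qed.

Lemma ae_prop (c : Prop) (P : SubSpace G -> Prop) :
  (c -> {ae mu, forall H, P H}) -> {ae mu, forall H, c -> P H}.
Proof.
move=> cP; have [hc|nc] := pselect c; last exact: aeW.
by apply: filterS (cP hc) => H.
Qed.

(* A Kac type estimate: the translates B i e_i are pairwise disjoint, so
   \sum_i mu (B i) <= 1 and almost every H lies in finitely many B i. *)
Lemma recurrence (k : G) (P : SubSpace G -> G -> Prop) :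
  (forall g, measurable [set H | P H g]) ->
  (forall H r, P H r -> forall g, P (conj_Sub r H) g <-> P H g) ->
  {ae mu, forall H, mem_Sub H k -> exists n, forall i, (n <= i)%N -> P H (e i) ->
    exists j, [/\ (j < i)%N, P H (e j) & mem_Sub H (k ^ (e i * (e j)^-1)^-1)]}.
Proof.
move=> mP conjP.
pose B i := [set H | mem_Sub H k /\ (P H (e i) /\ forall j, (j < i)%N ->
  P H (e j) -> ~ mem_Sub H (k ^ (e i * (e j)^-1)^-1))].
have mB i : measurable (B i).
  apply: measurable_pand; first exact: measurable_mem_Sub.
  apply: measurable_pand; first exact: mP.
  apply: measurable_pforall => j; apply: measurable_pimpl.
    exact: measurable_pcst.
  apply: measurable_pimpl; first exact: mP.
  by apply: measurable_pnot; exact: measurable_mem_Sub.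
have mconj g : measurable_fun setT (conj_Sub g : SubSpace G -> SubSpace G).
  apply: (measurable_fun_Sub e_onto) => x.
  exact: (measurable_mem_Sub (x ^ g^-1)).
pose C i := conj_Sub (e i)^-1 @^-1` B i.
have mC i : measurable (C i) by rewrite -[C i]setTI; exact: mconj.
have muC i : mu (C i) = mu (B i) by exact: mu_irs.
(* For H in both sets, k in H^(e_j^-1) says that k^((e_i e_j^-1)^-1) is in H^(e_i^-1), which
   contradicts the clause of B i on earlier indices; the invariance of P carries P (e_j) between
   these conjugates. *)
have disj i j H : (j < i)%N -> C i H -> C j H -> False.
  move=> ji [_ [Pi nPi]] [Hj [Pj _]].
  apply: (nPi j ji).
    have := conjP _ _ Pi (e j); rewrite conj_SubM mulVg conj_Sub1 => <-.
    by have := conjP _ _ Pj (e j); rewrite conj_SubM mulVg conj_Sub1 => ->.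
  move: Hj; rewrite !mem_conj_Sub => Hj.
  move: Hj; rewrite -conjgM; congr mem_Sub; congr (_ ^ _).
  by rewrite invgM !invgK mulgVK.
have tC : trivIset setT C.
  move=> i j _ _ [H [Ci Cj]]; apply/eqP; case: ltngtP => // ij; exfalso.
    exact: (disj j i H ij).
  exact: (disj i j H ij).
have sumB : (\sum_(i <oo) mu (B i) < +oo)%E.
  have -> : (\sum_(i <oo) mu (B i) = \sum_(i <oo) mu (C i))%E.
    by apply: eq_eseriesr => i _; rewrite muC.
  have sC : (\sum_(0 <= i < n) mu (C i))%E @[n --> \oo] --> mu (\bigcup_n C n).
    exact: measure_sigma_additive.
  rewrite (cvg_lim _ sC)// (le_lt_trans (probability_le1 mu _)) ?ltry//.
  exact: bigcup_measurable.
have lim0 := lim_sup_set_cvg0 mB sumB.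
exists (lim_sup_set B); split => //.
  by apply: bigcapT_measurable => n; apply: bigcup_measurable.
move=> H /= nH n _; apply: contrapT => nB; apply: nH => Hk; exists n => i ni Pi.
apply: contrapT => nj; apply: nB; exists i => //; split=> //; split=> // j ji Pj Hq.
by apply: nj; exists j.
Qed.

(** x is labelled by the least i with e_i in P and x e_i^-1 in Q. If i exceeded n, a return would
    give an earlier e_j with e_i e_j^-1 in Q, against minimality. *)
Lemma recurrence_finite_index H k (P Q : G -> Prop) n :
  is_subgroup P -> is_subgroup Q ->
  (forall q, P q -> mem_Sub H (k ^ q^-1) -> Q q) ->
  (forall i, (n <= i)%N -> P (e i) ->
    exists j, [/\ (j < i)%N, P (e j) & mem_Sub H (k ^ (e i * (e j)^-1)^-1)]) ->
  finite_index_in P Q.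
Proof.
move=> sP sQ PQ hn.
have /choice[f fP] : forall x, exists i : 'I_n.+1, P x ->
    P (e i) /\ Q (x * (e i)^-1).
  move=> x; have [Px|] := pselect (P x); last by exists ord0.
  have ex : exists i, `[< P (e i) /\ Q (x * (e i)^-1) >].
    have [i ei] := e_onto x; exists i; apply/asboolP; rewrite ei mulgV.
    by split=> //; exact: sQ.1.
  case: (ex_minnP ex) => i /asboolP[Pi Qi] imin.
  suff ni : (i < n.+1)%N by exists (Ordinal ni).
  rewrite ltnS leqNgt; apply/negP => /ltnW ni.
  have [j [ji Pj Hj]] := hn i ni Pi.
  have : (i <= j)%N.
    apply: imin; apply/asboolP; split=> //.
    rewrite -(mulgVK (e i) x) -mulgA; apply: subgroupM => //.
    by apply: PQ => //; exact: sP.2.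
  by rewrite leqNgt ji.
exists 'I_n.+1, f => x y Px Py fxy.
have [_ Qx] := fP x Px; have [_ Qy] := fP y Py.
rewrite fxy in Qx; rewrite -(mulgKA (e (f y))^-1).
exact: sQ.2.
Qed.

Section Branch.
Variables (a : G -> seq bool -> seq bool) (K : seq bool -> G -> Prop).
Hypothesis br : branching a K.

(** Recurrence for k = h and P = K_v: a return q satisfies q (q^-1)^(h^-1) = h^(q^-1) h^-1, so q is
    linked. Then for k = x y and P the normalizer of the intersection of H and K_v: conjugating H by
    an element of P keeps this intersection, hence P, unchanged. *)
Lemma ae_rich : {ae mu, forall H, rich a K (mem_Sub H)}.
Proof.
have ae1 h v : a h v <> v ->
    {ae mu, forall H, mem_Sub H h ->
      finite_index_in (K v) (linked a K (mem_Sub H) h v)}.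
  move=> hv; have := @recurrence h (fun _ => K v) (fun g => measurable_pcst _ (K v g))
    (fun _ _ _ _ => iff_refl _).
  apply: filterS => H hH Hh; have [n hn] := hH Hh.
  have sH := mem_Sub_subgroup H.
  apply: (recurrence_finite_index (br_sub br v) (linked_subgroup br sH hv) _ hn).
  move=> q Kq Hq; split=> //; exists ((q^-1) ^ h^-1).
    by apply: (br_conj br); exact: subgroupV (br_sub br v) Kq.
  have -> : q * q^-1 ^ h^-1 = h ^ q^-1 * h^-1 by rewrite !conjgE !invgK !mulgA.
  exact: sH.2.
have ae2 v x y : K v x -> (forall s, K v s -> commute s y) ->
    {ae mu, forall H, mem_Sub H (x * y) ->
      finite_index_in (normalizing K (mem_Sub H) v) (fun s => mem_Sub H [~ s, x])}.
  move=> Kx cy; have sK := br_sub br v.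
  have mN g : measurable [set H | normalizing K (mem_Sub H) v g].
    apply: measurable_pand; first exact: measurable_pcst.
    apply: (measurable_pforall_enum e_onto) => n.
    apply: measurable_pimpl; first exact: measurable_pcst.
    by apply: measurable_piff; exact: measurable_mem_Sub.
  have conjN H r : normalizing K (mem_Sub H) v r ->
      forall n, K v n -> mem_Sub (conj_Sub r H) n <-> mem_Sub H n.
    move=> [Kr rH] n Kn; rewrite mem_conj_Sub.
    have Knr : K v (n ^ r^-1) by apply: subgroupJ => //; exact: subgroupV.
    by rewrite (rH _ Knr) conjgKV.
  have := @recurrence (x * y) (fun H => normalizing K (mem_Sub H) v) mN.
  move=> aeN; apply: filterS (aeN _) => [H hH Hxy|H r Nr g].
    have [n hn] := hH Hxy; have sH := mem_Sub_subgroup H.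
    have sN := normalizing_subgroup br (mem_Sub H) v.
    have sC := centralizing_subgroup br sH Kx.
    suff [T [f fP]] : finite_index_in (normalizing K (mem_Sub H) v)
        (fun s => normalizing K (mem_Sub H) v s /\ mem_Sub H [~ s, x]).
      by exists T, f => s t Ns Nt fst; exact: (fP s t Ns Nt fst).2.
    apply: (recurrence_finite_index sN sC _ hn) => q Nq Hq; split=> //.
    have [Kq qH] := Nq; have KqV := subgroupV sK Kq.
    (* y cancels in (x y)^(q^-1) (x y)^-1, so c is in H and in K_v. From c, conjugation by x y in H
       and then by q in the normalizer leads to [q, x]. *)
    pose c := q * x * q^-1 * x^-1.
    have Kc : K v c.
      by apply: sK.2 => //; apply: sK.2 => //; exact: subgroupM.
    have Hc : mem_Sub H c.
      have -> : c = (x * y) ^ q^-1 * (x * y)^-1.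
        rewrite conjgE invgK invgM /c -!mulgA; congr (_ * (_ * _)).
        by rewrite (mulgA y) -(cy _ KqV) !mulgA mulgK.
      exact: sH.2.
    have Kcx : K v (c ^ x) by exact: subgroupJ.
    have -> : [~ q, x] = (c ^ x) ^ q by rewrite /c commgEl !conjgE !mulgA !mulgVK.
    apply/(qH _ Kcx).1; have <- : c ^ (x * y) = c ^ x.
      by rewrite conjgM; apply/conjg_fixP/commgP; exact: cy.
    exact: subgroupJ.
  split=> -[Kg gH]; split=> // n Kn; have Kng : K v (n ^ g) by exact: subgroupJ.
    by rewrite -(conjN H r Nr n Kn) -(conjN H r Nr _ Kng); exact: gH.
  by rewrite (conjN H r Nr n Kn) (conjN H r Nr _ Kng); exact: gH.
have := ae_forall_enum (fun h => ae_forall_count (fun v => ae_prop (@ae1 h v))).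
have := ae_forall_count (fun v => ae_forall_enum (fun x => ae_forall_enum (fun y =>
  ae_prop (fun Kx => ae_prop (@ae2 v x y Kx))))).
apply: filterS2 => H h2 h1; split=> [h v Hh hv|v x y Hxy Kx cy].
  exact: (h1 h v hv Hh).
exact: (h2 v x y Kx cy Hxy).
Qed.

End Branch.
End IRS.

(** * Convergence of the approximations *)

Section CoSofic.
Variables (R : realType) (G : groupType) (a : G -> seq bool -> seq bool).
Variable K : seq bool -> G -> Prop.
Hypothesis br : branching a K.
Variable mu : probability (SubSpace G) R.
Hypothesis mu_irs : is_IRS mu.
Implicit Types H : SubSpace G.

Lemma measurable_alive v : measurable [set H | alive a H v].
Proof.
have [e e_onto] := br_countable br.
apply: measurable_pforall => m.
have mu_ u : measurable [set H : SubSpace G | size u = m /\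
    forall h, mem_Sub H h -> a h (v ++ u) = v ++ u].
  apply: measurable_pand; first exact: measurable_pcst.
  apply: (measurable_pforall_enum e_onto) => h.
  by apply: measurable_pimpl; [exact: measurable_mem_Sub|exact: measurable_pcst].
have := measurable_pexists mu_; congr measurable.
by apply/seteqP; split=> H [u] => [[um Hf]|um Hf]; exists u.
Qed.

(** Level transitivity and conjugation invariance of mu. *)
Lemma mu_alive_size v w : size v = size w ->
  mu [set H | alive a H v] = mu [set H | alive a H w].
Proof.
move=> /(br_trans br)[g <-]; rewrite -(mu_irs g (measurable_alive (a g v))).
congr (mu _); apply/seteqP; split=> H /=; rewrite /preimage /=.
  by move=> al; apply/(alive_conj br).
by move/(alive_conj br).
Qed.

(* If v1^k0 is dead while v1^k is alive for infinitely many k, each such k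
   costs the fixed amount mu (E) in the decreasing sequence
   n |-> mu (a given vertex of level n is alive). *)
Lemma ae_escapes v (S : pred nat) : (forall m, exists2 k, (m <= k)%N & S k) ->
  {ae mu, forall H, escapes a H v S}.
Proof.
move=> Sinf.
pose E := [set H | forall k, alive a H (v ++ nseq k true) /\
  (S k -> ~ alive a H (v ++ nseq k true ++ [:: false]))].
have mE : measurable E.
  apply: measurable_pforall => k; apply: measurable_pand; first exact: measurable_alive.
  apply: measurable_pimpl; first exact: measurable_pcst.
  by apply: measurable_pnot; exact: measurable_alive.
suff muE : mu E = 0%E.
  exists E; split=> // H /= nesc k; split.
    by apply: contrapT => nal; apply: nesc; exists k; left.
  by move=> Sk al; apply: nesc; exists k; right.
pose p n := fine (mu [set H | alive a H (nseq n true)]).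
have fin A : measurable A -> mu A \is a fin_num by move=> mA; exact: fin_num_measure.
have pE u : mu [set H | alive a H u] = (p (size u))%:E.
  rewrite fineK; last by apply: fin; exact: measurable_alive.
  by apply: mu_alive_size; rewrite size_nseq.
have EE : mu E = (fine (mu E))%:E by rewrite fineK//; exact: fin.
have p0 n : (0 <= p n)%R by exact/fine_ge0/measure_ge0.
have pS n : (p n.+1 <= p n)%R.
  rewrite -lee_fin -{2}(size_nseq n true) -pE -{1}[n.+1](size_nseq _ true) -pE.
  apply: le_measure; rewrite ?inE; [exact: measurable_alive..|] => H.
  by rewrite /mkset -[n.+1]addn1 nseqD => /(alive_cat br).
have pS' m n : (m <= n)%N -> (p n <= p m)%R.
  by move=> mn; rewrite -(subnKC mn); elim: (n - m)%N => [|i IH];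
    [rewrite addn0|rewrite addnS; exact: le_trans (pS _) IH].
(* E and the event that v1^k0 is alive are disjoint, and both are contained in the event that v1^k
   is alive. *)
have drop k : S k -> (fine (mu E) + p (size v + k).+1%N <= p (size v + k)%N)%R.
  move=> Sk; pose A := [set H | alive a H (v ++ nseq k true ++ [:: false])].
  have mA : measurable A by exact: measurable_alive.
  have -> : (size v + k)%N = size (v ++ nseq k true) by rewrite size_cat size_nseq.
  have e : (size (v ++ nseq k true)).+1 = size (v ++ nseq k true ++ [:: false]).
    by rewrite !size_cat size_nseq addn1 addnS.
  rewrite e -lee_fin EFinD -EE -!pE -/A -measureU//; last first.
    by apply/seteqP; split=> // H [/= /(_ k)[_ /(_ Sk)]].
  apply: le_measure; rewrite ?inE; [exact: measurableU|exact: measurable_alive|].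
  by move=> H [/(_ k)[]//|]; rewrite /A /= catA => /(alive_cat br).
have small N : exists m, (p m <= p 0 - N%:R * fine (mu E))%R.
  elim: N => [|N [m pm]]; first by exists 0%N; rewrite mul0r subr0.
  have [k mk Sk] := Sinf m; exists (size v + k).+1.
  have := drop k Sk; rewrite addrC -lerBrDr => /le_trans; apply.
  rewrite -natr1 mulrDl mul1r opprD addrA lerB//.
  by apply: le_trans pm; apply: pS'; rewrite (leq_trans mk)// leq_addl.
rewrite EE; congr _%:E; apply/eqP; rewrite eq_le fine_ge0 ?measure_ge0// andbT.
rewrite leNgt; apply/negP => E0.
have [m] := small (Num.truncn (p 0 / fine (mu E))).+1.
have : (p 0 < (Num.truncn (p 0 / fine (mu E))).+1%:R * fine (mu E))%R.
  by rewrite -ltr_pdivrMr//; exact: truncnS_gt.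
rewrite -subr_lt0 => lt0 /le_lt_trans /(_ lt0).
by rewrite ltNge p0.
Qed.

Lemma ae_germ_rigid : {ae mu, forall H, germ_rigid a H}.
Proof.
have [e e_onto] := br_countable br.
have germs g : exists n S, forall v, size v = n -> a g v = v -> germ_at a g v (S v).
  have [n gn] := br_germ br g; exists n.
  suff /choice[S hS] : forall v, exists S, size v = n -> a g v = v -> germ_at a g v S.
    by exists S.
  move=> v; have [vn|] := pselect (size v = n); last by exists pred0.
  have [gv|] := pselect (a g v = v); last by exists pred0.
  by have [S hS] := gn v vn gv; exists S.
apply: (ae_forall_enum e_onto) => g; have [n [S gS]] := germs g.
have := ae_forall_count (fun v => ae_prop (@ae_escapes v (S v))).
by apply: filterS => H esc gal; exact: (fixing_trivial_near br gS esc gal).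
Qed.

Lemma measurable_fun_Phi n : measurable_fun setT (Phi br n).
Proof.
have [e e_onto] := br_countable br.
apply: (measurable_fun_Sub e_onto) => g.
suff : measurable [set H | Phi_spec a n H g].
  congr measurable; apply/seteqP; split=> H /=; first by move=> ?; exact/(mem_Phi br).
  by move/(mem_Phi br).
have mal v : measurable [set H | alive a H v] := measurable_alive v.
apply: measurable_pand.
  apply: measurable_pforall => v; apply: measurable_pimpl; first exact: measurable_pcst.
  by apply: measurable_pimpl => //; exact: measurable_pcst.
apply: (measurable_pexists_enum e_onto) => h.
have : measurable [set H : SubSpace G | mem_Sub H h /\
    ((forall v, size v = n -> alive a H v -> forall w, a h (v ++ w) = v ++ w) /\
    (forall v, size v = n -> ~ alive a H v -> forall w, a g (v ++ w) = a h (v ++ w)))].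
  apply: measurable_pand; first exact: measurable_mem_Sub.
  apply: measurable_pand; apply: measurable_pforall => v;
    (apply: measurable_pimpl; first exact: measurable_pcst).
    by apply: measurable_pimpl => //; exact: measurable_pcst.
  by apply: measurable_pimpl; [exact: measurable_pnot|exact: measurable_pcst].
congr measurable; apply/seteqP; split=> H /=; first by move=> [? [? ?]].
by move=> [? ? ?].
Qed.

Definition Phi_mfun n : {mfun SubSpace G >-> SubSpace G} :=
  MeasurableFun.Pack (MeasurableFun.Class
    (isMeasurableFun.Build _ _ _ _ _ (measurable_fun_Phi n))).

Definition approximant n : probability (SubSpace G) R := distribution mu (Phi_mfun n).

Lemma approximantE n A : approximant n A = mu (Phi br n @^-1` A).
Proof. by []. Qed.

Lemma approximant_IRS n : is_IRS (approximant n).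
Proof.
move=> g A mA; rewrite !approximantE.
have mPA : measurable (Phi br n @^-1` A).
  by rewrite -[X in measurable X]setTI; exact: measurable_fun_Phi.
rewrite -(mu_irs g mPA); congr (mu _).
by apply/seteqP; split=> H; rewrite /preimage /= Phi_conj.
Qed.

(** Finite index expressed through countably many membership events, so as to be visibly
    measurable. *)
Definition covered_by (e : nat -> G) H (N : nat) : Prop :=
  forall g, exists i, (i < N)%N /\ mem_Sub H (g * (e i)^-1).

Lemma finite_index_covered e H : (forall g, exists n, e n = g) ->
  finite_index_in (fun=> True) (mem_Sub H) -> exists N, covered_by e H N.
Proof.
move=> e_onto [T [f fP]].
have /choice[r rP] : forall t : T, exists i, (exists x, f x = t) -> f (e i) = t.
  move=> t; have [[x fx]|] := pselect (exists x, f x = t); last by exists 0%N.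
  by have [i ei] := e_onto x; exists i; rewrite ei.
exists (\max_t r t).+1 => g; exists (r (f g)); split.
  by rewrite ltnS; exact: leq_bigmax.
by apply: fP => //; rewrite rP//; exists g.
Qed.

Lemma covered_finite_index e H N : covered_by e H N -> finite_index H.
Proof.
move=> cov; have sH := mem_Sub_subgroup H.
apply: (@sub_finite_set _ _ [set right_coset H (e i) | i in `I_N]);
  last by apply: finite_image; exact: finite_II.
move=> _ [x _ <-]; have [i [iN Hx]] := cov x; exists i => //.
apply/seteqP; split=> y /= [h /= Hh <-].
  exists (h * (x * (e i)^-1)^-1); first exact: sH.2.
  by rewrite invgM invgK -!mulgA mulVg mulg1.
exists (h * (x * (e i)^-1)); first exact: (subgroupM sH).
by rewrite -!mulgA mulVg mulg1.
Qed.

Lemma approximant_finite_index n :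
  {ae approximant n, forall H, finite_index H}.
Proof.
have [e e_onto] := br_countable br.
pose F := [set H | exists N, covered_by e H N].
have mF : measurable F.
  apply: measurable_pexists => N; apply: (measurable_pforall_enum e_onto) => g.
  apply: measurable_pexists => i; apply: measurable_pand; first exact: measurable_pcst.
  exact: measurable_mem_Sub.
exists (~` F); split; first exact: measurableC.
  rewrite approximantE; apply/negligibleP.
    rewrite -[X in measurable X]setTI; apply: measurable_fun_Phi => //.
    exact: measurableC.
  have [N [mN muN sN]] := ae_rich e_onto mu_irs br; exists N; split=> // H /= nF.
  apply: sN => /= rH; apply: nF; apply: finite_index_covered => //.
  exact: finite_index_Phi.
by move=> H /= nfi [N /covered_finite_index].
Qed.

(** The integral against the law of Phi_n H is that of f(Phi_n H) against mu. Compactness bounds f,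
    Phi_n H tends to H almost surely, and dominated convergence concludes. *)
Lemma approximant_cvg : weak_star_cvg approximant mu.
Proof.
have [e e_onto] := br_countable br.
move=> f cf; have mf := continuous_measurable_Sub cf.
have [M fM] := continuous_bounded_Sub cf.
pose F H : \bar R := (f H)%:E.
have mF : measurable_fun setT F by exact/measurable_EFinP.
have mFP n : measurable_fun setT (F \o Phi br n).
  by apply: measurableT_comp => //; exact: measurable_fun_Phi.
have iM : mu.-integrable setT (cst M%:E).
  exact: finite_measure_integrable_cst.
have Mb H : (`|F H| <= M%:E)%E by rewrite lee_fin.
have iFP n : mu.-integrable setT (F \o Phi br n).
  by apply: le_integrable iM => // H _ /=; rewrite (le_trans (Mb _))// lee_fin ler_norm.
have eP n : (\int[approximant n]_H F H = \int[mu]_H (F \o Phi br n) H)%E.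
  exact: (integral_pushforward (measurable_fun_Phi n) mF (iFP n)).
have cvgF : {ae mu, forall H, setT H -> (F \o Phi br n) H @[n --> \oo] --> F H}.
  apply: filterS ae_germ_rigid => H rig _.
  apply/fine_cvgP; split; first exact: nearW.
  apply: (@cvg_comp _ _ _ (fun n => Phi br n H) f); last exact: cf.
  by apply: cvg_Sub_seq => g; exact: Phi_cvg_mem.
have bF : {ae mu, forall H n, setT H -> (`|(F \o Phi br n) H| <= cst M%:E H)%E}.
  by apply: aeW => H n _; exact: Mb.
have [iF _ cv] := dominated_convergence measurableT mFP mF cvgF iM bF.
apply: fine_cvg; rewrite fineK; last exact: integrable_fin_num.
by under eq_fun do rewrite eP.
Qed.

End CoSofic.

Theorem corollary6p16 (R : realType) (omega : nat -> 'I_3) :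
  Omega' omega ->
  forall mu : probability (SubSpace (grigorchuk omega)) R,
    is_IRS mu -> co_sofic mu.
Proof.
move=> /recurrent_Omega'/grigorchuk_branching br mu mu_irs.
exists (approximant br mu); split.
- exact: approximant_IRS.
- exact: approximant_finite_index.
- exact: approximant_cvg.
Qed.
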